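(* Let $R=k[x_1,\ldots,x_d]$ be a polynomial ring over a field $k$, let $\mathfrak{m}=(x_1,\ldots,x_d)$, let $(I_n)_{n\geq 0}$ be a Noetherian graded family of monomial ideals of $R$, and fix an integer $i\geq 0$. Assume $\lambda(\operatorname{H}^i_{\mathfrak m}(R/I_n))<\infty$ for $n\gg 0$. Then the sequence $\{\lambda(\operatorname{H}^i_{\mathfrak m}(R/I_n))\}_{n\geq 0}$ agrees with a quasi-polynomial of degree at most $d$ for $n\gg 0$. Moreover, this sequence has a rational generating function.
   Context: $\lambda(-)$ denotes length and $\operatorname{H}^i_{\mathfrak m}(-)$ local cohomology. A family of ideals $(I_n)_{n\geq 0}$ is graded if $I_0=R$ and $I_nI_m\subseteq I_{m+n}$ for all $n,m\geq 0$; it is Noetherian if $\bigoplus_{n\geq 0} I_nt^n$ is a finitely generated ($R$-)algebra. A quasi-polynomial in $n$ is a function $f:\mathbb{N}\to\mathbb{Q}$ for which there exist a positive integer $\pi$ and polynomials $p_0,\ldots,p_{\pi-1}\in\mathbb{Q}[n]$ with $f(n)=p_j(n)$ whenever $n\equiv j \pmod \pi$; its degree is the maximum of the degrees of the $p_j$. A sequence $\{s_n\}_{n\geq 0}$ has a rational generating function if $\sum_{n\in\mathbb{N}} s_n x^n$ can be written as $\frac{q(x)}{(1-x^{b_1})\cdots(1-x^{b_r})}$ for some $q(x)\in\mathbb{Q}[x]$ and positive integers $b_1,\ldots,b_r$. *)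

(* Defs.v *)
From HB Require Import structures.
From mathcomp Require Import all_boot all_order all_algebra.
From mathcomp Require Import boolp.
From mathcomp Require Import mpoly.

Set Implicit Arguments.
Unset Strict Implicit.
Unset Printing Implicit Defensive.

Import GRing.Theory.

Local Open Scope ring_scope.
Local Open Scope quotient_scope.

(* Submodules are the [submodClosed] predicates of the library; ideals are the
   submodules of the regular module.  The unit ideal is allowed, unlike in
   [idealr]. *)
Notation ideal R := (submodClosed R^o).

Section SubmoduleType.
Variables (R : comNzRingType) (M : lmodType R) (N : submodClosed M).

Definition submod_type : Type := {x : M | x \in N}.

HB.instance Definition _ := SubType.on submod_type.
HB.instance Definition _ := Choice.on submod_type.
HB.instance Definition _ := [SubChoice_isSubLmodule of submod_type by <:].

End SubmoduleType.

Section QuotientModule.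
Variables (R : comNzRingType) (M : lmodType R) (N : submodClosed M).

(* The library quotient expects a [zmodClosed] predicate, which a
   [submodClosed] one is not by inheritance. *)
Definition submod_zmod : {pred M} := fun x => x \in N.
HB.instance Definition _ := GRing.isZmodClosed.Build M submod_zmod
  (GRing.submod_closedB (submodClosedP N)).

Definition quotmod : Type := Quotient.quot submod_zmod.

HB.instance Definition _ := GRing.Zmodule.on quotmod.

Definition quotmod_pi (x : M) : quotmod := \pi_(Quotient.quot submod_zmod) x.

Lemma quotmod_piP x y : (quotmod_pi x = quotmod_pi y) <-> (x - y \in N).
Proof.
have := Quotient.idealrBE submod_zmod x y; rewrite /quotmod_pi => E.
by split=> [/eqP|xy]; [rewrite -E | apply/eqP; rewrite -E].
Qed.

Definition quotmod_scale (a : R) (u : quotmod) : quotmod :=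
  quotmod_pi (a *: (repr (u : Quotient.quot submod_zmod) : M)).

Lemma quotmod_reprK (u : quotmod) :
  quotmod_pi (repr (u : Quotient.quot submod_zmod)) = u.
Proof. exact: reprK. Qed.

Lemma quotmod_piD x y : quotmod_pi (x + y) = quotmod_pi x + quotmod_pi y.
Proof. exact: (raddfD (\pi_(Quotient.quot submod_zmod))). Qed.

Lemma quotmod_piZ a x : quotmod_scale a (quotmod_pi x) = quotmod_pi (a *: x).
Proof.
apply/quotmod_piP; rewrite -scalerBr; apply: rpredZ.
by apply/quotmod_piP; rewrite quotmod_reprK.
Qed.

Lemma quotmod_scaleA a b u :
  quotmod_scale a (quotmod_scale b u) = quotmod_scale (a * b) u.
Proof. by rewrite -(quotmod_reprK u) !quotmod_piZ scalerA. Qed.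

Lemma quotmod_scale1 : left_id 1 quotmod_scale.
Proof. by move=> u; rewrite -(quotmod_reprK u) quotmod_piZ scale1r. Qed.

Lemma quotmod_scaleDr : right_distributive quotmod_scale +%R.
Proof.
move=> a u v; rewrite -(quotmod_reprK u) -(quotmod_reprK v).
by rewrite -quotmod_piD !quotmod_piZ scalerDr quotmod_piD.
Qed.

Lemma quotmod_scaleDl u : {morph quotmod_scale^~ u : a b / a + b}.
Proof.
by move=> a b; rewrite -(quotmod_reprK u) !quotmod_piZ scalerDl quotmod_piD.
Qed.

HB.instance Definition _ := GRing.Zmodule_isLmodule.Build R quotmod
  quotmod_scaleA quotmod_scale1 quotmod_scaleDr quotmod_scaleDl.

End QuotientModule.

Definition has_chain (R : comNzRingType) (M : lmodType R) (l : nat) : Prop :=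
  exists N : nat -> submodClosed M, forall j, (j < l)%N ->
    {subset N j <= N j.+1} /\ exists2 x, x \in N j.+1 & x \notin N j.

(* The length of M is the supremum of the lengths of strict chains of
   submodules; [has_length M l] says that it is finite and equal to l. *)
Definition has_length (R : comNzRingType) (M : lmodType R) (l : nat) : Prop :=
  has_chain M l /\ forall l', has_chain M l' -> (l' <= l)%N.

Definition finite_length (R : comNzRingType) (M : lmodType R) : Prop :=
  exists l, has_length M l.

Section Ideals.
Variable R : comNzRingType.

Definition ideal_gen (G : R -> Prop) : {pred R^o} := fun f =>
  `[< exists s : seq (R * R),
        (forall p, p \in s -> G p.2) /\ f = \sum_(p <- s) p.1 * p.2 >].

Lemma ideal_gen_closed G : submod_closed (ideal_gen G).
Proof.
split=> [|a u v /asboolP[s [sG ->]] /asboolP[t [tG ->]]].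
  by apply/asboolP; exists [::]; split=> //; rewrite big_nil.
apply/asboolP; exists ([seq (a * p.1, p.2) | p <- s] ++ t); split.
  by move=> p; rewrite mem_cat => /orP[/mapP[q /sG Gq ->]|/tG].
rewrite big_cat big_map /= scaler_sumr; congr (_ + _).
by apply: eq_bigr => p _; rewrite -mulrA.
Qed.

HB.instance Definition _ G :=
  GRing.isSubmodClosed.Build R R^o (ideal_gen G) (ideal_gen_closed G).

Definition ideal_mul (I J : ideal R) : ideal R :=
  ideal_gen (fun f => exists a b, [/\ a \in I, b \in J & f = a * b]).

Fixpoint ideal_pow (I : ideal R) (n : nat) : ideal R :=
  if n is m.+1 then ideal_mul I (ideal_pow I m) else ideal_gen (fun f => f = 1).

Lemma ideal_pow_le (I : ideal R) n n' f :
  (n <= n')%N -> f \in ideal_pow I n' -> f \in ideal_pow I n.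
Proof.
move=> /subnK <-; elim: (n' - n)%N f => [//|k IHk] f /asboolP[s [sP ->]].
apply: IHk; rewrite big_seq; apply: rpred_sum => p /sP[a [b [_ Ib ->]]].
by rewrite mulrA; apply: (rpredZ (_ : R) Ib).
Qed.

End Ideals.

Definition injective_module (R : comNzRingType) (E : lmodType R) : Prop :=
  forall (A B : lmodType R) (h : {linear A -> B}) (f : {linear A -> E}),
    injective h -> exists g : {linear B -> E}, forall x, g (h x) = f x.

Record injective_resolution (R : comNzRingType) (M : lmodType R) := {
  res_obj :> nat -> lmodType R;
  res_aug : {linear M -> res_obj 0%N};
  res_d : forall j, {linear res_obj j -> res_obj j.+1};
  res_inj : forall j, injective_module (res_obj j);
  res_aug_inj : injective res_aug;
  res_exact0 : forall x, res_d 0%N x = 0 <-> exists y, x = res_aug y;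
  res_exactS : forall j x, res_d j.+1 x = 0 <-> exists y, x = res_d j y
}.

Section LocalCohomology.
Variables (R : comNzRingType) (m : ideal R).

(* The torsion functor Gamma_m; local cohomology is its right derived functor,
   so below cocycles and coboundaries are those of the complex Gamma_m(E). *)
Definition torsion (E : lmodType R) : {pred E} := fun x =>
  `[< exists n, forall f, f \in ideal_pow m n -> f *: x = 0 >].
Arguments torsion E : clear implicits.

Lemma torsion_closed E : submod_closed (torsion E).
Proof.
split=> [|a x y /asboolP[n xn] /asboolP[n' yn]].
  by apply/asboolP; exists 0%N => f _; rewrite scaler0.
apply/asboolP; exists (maxn n n') => f If; rewrite scalerDr scalerA mulrC.
rewrite -scalerA xn ?yn ?scaler0 ?addr0 //.
  exact: ideal_pow_le (leq_maxr n n') If.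
exact: ideal_pow_le (leq_maxl n n') If.
Qed.

HB.instance Definition _ E :=
  GRing.isSubmodClosed.Build R E (torsion E) (torsion_closed E).

Variables (M : lmodType R) (E : injective_resolution M).

Definition cocycles (i : nat) : {pred E i} := fun x =>
  (x \in torsion (E i)) && (res_d E i x == 0).
Arguments cocycles i : clear implicits.

Definition coboundaries (i : nat) : {pred E i} :=
  match i with
  | 0 => fun x => x == 0
  | j.+1 => fun x => `[< exists2 y, y \in torsion (E j) & x = res_d E j y >]
  end.
Arguments coboundaries i : clear implicits.

Lemma cocycles_closed i : submod_closed (cocycles i).
Proof.
split=> [|a x y /andP[tx /eqP dx] /andP[ty /eqP dy]]; apply/andP; split.
- exact: rpred0.
- by rewrite linear0.
- by rewrite rpredD ?rpredZ.
- by rewrite linearP dx dy scaler0 addr0.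
Qed.

HB.instance Definition _ i :=
  GRing.isSubmodClosed.Build R (E i) (cocycles i) (cocycles_closed i).

Lemma coboundaries_closed i : submod_closed (coboundaries i).
Proof.
case: i => [|j]; split.
- exact: eqxx.
- by move=> a x y /eqP-> /eqP->; rewrite scaler0 addr0; exact: eqxx.
- by apply/asboolP; exists 0; rewrite ?rpred0 ?linear0.
move=> a x y /asboolP[u tu ->] /asboolP[v tv ->]; apply/asboolP.
by exists (a *: u + v); rewrite ?linearP // rpredD ?rpredZ.
Qed.

Definition coboundaries_in (i : nat) : {pred submod_type (cocycles i)} :=
  fun z => val z \in coboundaries i.
Arguments coboundaries_in i : clear implicits.

Lemma coboundaries_in_closed i : submod_closed (coboundaries_in i).
Proof.
have [B0 BD] := coboundaries_closed i; split=> [|a x y Bx By].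
  by rewrite unfold_in /coboundaries_in raddf0.
by rewrite unfold_in /coboundaries_in linearP; apply: BD.
Qed.

HB.instance Definition _ i := GRing.isSubmodClosed.Build R
  (submod_type (cocycles i)) (coboundaries_in i) (coboundaries_in_closed i).

(* H^i_m(M) = H^i(Gamma_m(E)), computed from the injective resolution E of M *)
Definition local_cohomology (i : nat) : lmodType R :=
  quotmod (coboundaries_in i).

End LocalCohomology.

Arguments torsion {R} m E x : rename.
Arguments cocycles {R} m {M} E i x : rename.
Arguments coboundaries {R} m {M} E i x : rename.
Arguments coboundaries_in {R} m {M} E i z : rename.

Section Monomial.
Variables (k : fieldType) (d : nat).
Local Notation R := {mpoly k[d]}.

Definition monomial_ideal (I : ideal R) : Prop :=
  exists S : 'X_{1..d} -> Prop,
    I =i ideal_gen (fun f : R => exists2 a, S a & f = 'X_[a]).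

Definition irrelevant_ideal : ideal R :=
  ideal_gen (fun f : R => exists j : 'I_d, f = 'X_j).

End Monomial.

Section Families.
Variable R : comNzRingType.

Definition graded_family (I : nat -> ideal R) : Prop :=
  (forall f, f \in I 0%N) /\
  forall n n', {subset ideal_mul (I n) (I n') <= I (n + n')%N}.

(* The direct sum of the I n t^n, as a subset of R[t]. *)
Definition rees_algebra (I : nat -> ideal R) (p : {poly R}) : Prop :=
  forall n, p`_n \in I n.

Definition noetherian_family (I : nat -> ideal R) : Prop :=
  exists (r : nat) (g : 'I_r -> {poly R}),
    (forall j, rees_algebra I (g j)) /\
    forall p, rees_algebra I p -> exists q : {mpoly R[r]}, p = mmap polyC g q.

End Families.

Definition quasi_polynomial_deg_le (e : nat) (f : nat -> rat) : Prop :=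
  exists (c : nat) (p : nat -> {poly rat}), [/\ (0 < c)%N,
    forall j, (j < c)%N -> (size (p j) <= e.+1)%N &
    forall n, f n = (p (n %% c)%N).[n%:R]].

(* The identity (\sum_n s_n x^n) (\prod_j (1 - x^b_j)) = q(x) of formal power
   series, coefficient by coefficient. *)
Definition rational_generating_function (s : nat -> rat) : Prop :=
  exists (q : {poly rat}) (b : seq nat), all (fun c => 0 < c)%N b /\
    forall n, \sum_(j < n.+1) s (n - j)%N * (\prod_(c <- b) (1 - 'X^c))`_j = q`_n.

(* Main.v *)
Require Import Defs.
From HB Require Import structures.
From mathcomp Require Import all_boot all_order all_algebra.
From mathcomp Require Import boolp.
From mathcomp Require Import mpoly.
From mathcomp Require Import zify ring lra.

Set Implicit Arguments.
Unset Strict Implicit.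
Unset Printing Implicit Defensive.

Import Order.TTheory GRing.Theory Num.Theory.

Local Open Scope ring_scope.

(** The length of the [i]-th local cohomology of [R / I_n] is a sum over the
    lattice points of a box that grows linearly in [n], of a function that only
    depends on which of finitely many finitely generated semigroups contain the
    point.

    Algebra. For an injective module [E] the Koszul complex of the [x_j ^ t] with
    values in [E] is a resolution of the submodule killed by the [x_j ^ t]: this
    only uses that the powers form a regular sequence and that maps into [E]
    extend ([injective_coregular], [koszul_exact]). Dimension shifting along an
    injective resolution of [M] then identifies the local cohomology of [M] with
    the colimit over [t] of the Koszul cohomology of [M] ([dim_ge_shifts],
    [dim_ge_augmentation]). No colimit and no localization is formed: a class is
    a Koszul cocycle for some [t], and it vanishes when its image for some larger
    exponent is a coboundary. Local cohomology is torsion, so that its length is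
    its dimension over [k] ([local_cohomology_chain]).

    For a monomial ideal [I] everything is graded by the integer vectors [a]. In
    degree [a] the complex of [R / I] becomes stationary for large [t]: it is the
    Koszul complex of the sequence [1, ..., 1] over [k], restricted to the
    subsets [T] of the variables for which [x ^ a] is a nonzero element of the
    localization of [R / I] at [T] ([degree_pattern], [alive_pattern]). So the
    contribution of [a] is a function [pattern_dim] of this set of subsets
    ([koszul_dim_le], [koszul_dim_ge]).

    Geometry. The pairs [(m, n)] with [x ^ m] in [I_n] form a finitely generated
    semigroup ([rees_semigroup]), and so do the corresponding pairs for each
    localization ([local_semigroupP]). If a coordinate of a degree [a] is
    negative, or larger than a constant times [n], moving it to infinity does not
    change the pattern; since the length is finite, all contributing degrees lie
    in a box of side proportional to [n] ([degree_dim_box]).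

    Counting. A sum over the box of a function of finitely many memberships is a
    linear combination of numbers of points of height [n] in finitely generated
    semigroups ([rat_gf_sum_membership], by Gordan's lemma [fin_genI]). Such
    points correspond to the monomials outside a monomial ideal
    ([rat_gf_fin_gen]), whose number has a rational generating function by
    noetherian induction ([outside_count_rat_gf]). A sequence with a rational
    generating function is eventually a quasi-polynomial, and the number of
    points of the box bounds its degree by [d] ([rat_gf_quasi_polynomial]). *)

(** * Sequences with a rational generating function *)

Section Convolution.

(** The n-th coefficient of the product of the polynomial [Q] and the power
    series with coefficients [f]. *)
Definition conv (Q : {poly rat}) (f : nat -> rat) (n : nat) : rat :=
  \sum_(j < n.+1) f (n - j)%N * Q`_j.

Implicit Types (P Q : {poly rat}) (f g : nat -> rat).

Lemma convE Q f n m : (n <= m)%N ->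
  conv Q f n = (Q * \poly_(i < m.+1) f i)`_n.
Proof.
move=> nm; rewrite coefM; apply: eq_bigr => j _; rewrite mulrC coef_poly.
by have -> : (n - j < m.+1)%N by lia.
Qed.

Lemma convM P Q f n : conv (P * Q) f n = conv P (conv Q f) n.
Proof.
rewrite (convE _ _ (leqnn n)) -mulrA coefM; apply: eq_bigr => j _.
by rewrite mulrC (@convE _ _ _ n) // leq_subr.
Qed.

Lemma convC P Q f n : conv P (conv Q f) n = conv Q (conv P f) n.
Proof. by rewrite -!convM mulrC. Qed.

Lemma eq_conv Q f g n : (forall m, (m <= n)%N -> f m = g m) ->
  conv Q f n = conv Q g n.
Proof. by move=> fg; apply: eq_bigr => j _; rewrite fg // leq_subr. Qed.

Lemma convDr Q f g n : conv Q (fun m => f m + g m) n = conv Q f n + conv Q g n.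
Proof. by rewrite -big_split; apply: eq_bigr => j _; rewrite mulrDl. Qed.

Lemma convZr Q a f n : conv Q (fun m => a * f m) n = a * conv Q f n.
Proof. by rewrite big_distrr; apply: eq_bigr => j _; rewrite -mulrA. Qed.

Lemma convXn w f n : conv 'X^w f n = if (w <= n)%N then f (n - w)%N else 0.
Proof.
rewrite (convE _ _ (leqnn n)) coefXnM coef_poly.
by case: leqP => // wn; have -> : (n - w < n.+1)%N by lia.
Qed.

Lemma conv1BXn w f n :
  conv (1 - 'X^w) f n = f n - (if (w <= n)%N then f (n - w)%N else 0).
Proof.
rewrite (convE _ _ (leqnn n)) mulrBl mul1r coefB coef_poly ltnS leqnn.
by rewrite -(convE _ _ (leqnn n)) convXn.
Qed.

Lemma conv_eventually0 Q f N : (forall n, (N <= n)%N -> f n = 0) ->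
  forall n, (N + size Q <= n)%N -> conv Q f n = 0.
Proof.
move=> f0 n nN; apply: big1 => j _; case: (leqP (size Q) j) => jQ.
  by rewrite nth_default // mulr0.
by rewrite f0 ?mul0r //; have := ltn_ord j; lia.
Qed.

Definition rat_denom (b : seq nat) : {poly rat} := \prod_(c <- b) (1 - 'X^c).

Definition rat_gf (f : nat -> rat) : Prop :=
  exists (b : seq nat) (N : nat), all (fun c => 0 < c)%N b /\
    forall n, (N <= n)%N -> conv (rat_denom b) f n = 0.

Lemma rat_gf_rational f : rat_gf f -> rational_generating_function f.
Proof.
move=> [b [N [b0 fN]]]; exists (\poly_(i < N) conv (rat_denom b) f i), b.
split=> // n; rewrite coef_poly; case: ltnP => // /fN.
by rewrite /conv => ->.
Qed.

Lemma rat_gf_eventually f g N :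
  (forall n, (N <= n)%N -> f n = g n) -> rat_gf f -> rat_gf g.
Proof.
move=> fg [b [N' [b0 fN]]]; exists b, (N' + N + size (rat_denom b))%N.
split=> // n nN.
rewrite (@eq_conv _ _ (fun m => f m + (g m - f m))) => [|m _]; last first.
  by rewrite addrC subrK.
rewrite convDr fN; last by lia.
rewrite (@conv_eventually0 _ (fun m => g m - f m) N) ?addr0 // => [m|]; last lia.
by move=> /fg ->; rewrite subrr.
Qed.

Lemma rat_gf_conv P f : rat_gf f -> rat_gf (conv P f).
Proof.
move=> [b [N [b0 fN]]]; exists b, (N + size P)%N; split=> // n nN.
by rewrite convC (@conv_eventually0 _ _ N).
Qed.

Lemma rat_gf_eventually0 f N : (forall n, (N <= n)%N -> f n = 0) -> rat_gf f.
Proof.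
move=> f0; exists [::], (N + size (rat_denom [::]))%N; split=> // n.
exact: conv_eventually0.
Qed.

Lemma rat_gfD f g : rat_gf f -> rat_gf g -> rat_gf (fun n => f n + g n).
Proof.
move=> [b [N [b0 fN]]] [b' [N' [b0' gN']]].
exists (b ++ b'), (N + N' + size (rat_denom b) + size (rat_denom b'))%N.
split=> [|n nN]; first by rewrite all_cat b0.
have ->: rat_denom (b ++ b') = rat_denom b * rat_denom b'.
  exact: big_cat.
rewrite convDr {1}mulrC !convM (@conv_eventually0 _ (conv _ f) N) //; last lia.
by rewrite (@conv_eventually0 _ (conv _ g) N') ?addr0 //; lia.
Qed.

Lemma rat_gfZ a f : rat_gf f -> rat_gf (fun n => a * f n).
Proof.
move=> [b [N [b0 fN]]]; exists b, N; split=> // n nN.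
by rewrite convZr fN ?mulr0.
Qed.

(** Summation along steps of length [w] only adds a factor to the
    denominator. *)
Lemma rat_gf_antidiff w f : (0 < w)%N -> rat_gf (conv (1 - 'X^w) f) -> rat_gf f.
Proof.
move=> w0 [b [N [b0 fN]]]; exists (w :: b), N; split=> [|n nN] /=.
  by rewrite w0.
by rewrite /rat_denom big_cons mulrC convM fN.
Qed.

End Convolution.

(** * From rational generating functions to quasi-polynomials *)

Lemma size_rising s : size (\prod_(i < s) ('X + i%:R%:P) : {poly rat}) = s.+1.
Proof.
rewrite -(big_mkord xpredT (fun i => 'X + i%:R%:P)).
rewrite (eq_bigr (fun i => 'X - (- i%:R)%:P)) => [|i _].
  by rewrite size_prod_XsubC size_iota subn0.
by rewrite polyCN opprK.
Qed.

Lemma monic_rising s : (\prod_(i < s) ('X + i%:R%:P) : {poly rat}) \is monic.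
Proof.
by apply: monic_prod => i _; rewrite -[i%:R%:P]opprK -polyCN monicXsubC.
Qed.

(** Rising factorials form a basis of the polynomials on which the backward
    difference acts by the rule [x^(s+1) |-> (s+1) x^(s)]; hence it has a right
    inverse that raises the degree by one. *)
Lemma poly_antidifference s (p : {poly rat}) : (size p <= s)%N ->
  exists q : {poly rat}, (size q <= s.+1)%N /\
    forall x, q.[x] - q.[x - 1] = p.[x].
Proof.
pose b t : {poly rat} := \prod_(i < t) ('X + i%:R%:P).
elim: s p => [|s IHs] p sp.
  move: sp; rewrite leqn0 size_poly_eq0 => /eqP ->; exists 0.
  by rewrite size_poly0; split=> // x; rewrite !horner0 subrr.
have [|q [sq qE]] := IHs (p - p`_s *: b s).
  apply/leq_sizeP => i si; rewrite coefB coefZ.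
  have := monic_rising s; rewrite monicE lead_coefE size_rising /= => /eqP bs.
  case: (ltngtP s i) si => // [si _|<- _]; last by rewrite bs mulr1 subrr.
  rewrite nth_default ?(leq_trans sp) //.
  by rewrite [(b s)`_i]nth_default ?mulr0 ?subrr // size_rising.
exists (q + (p`_s / s.+1%:R) *: b s.+1); split=> [|x].
  rewrite (leq_trans (size_polyD _ _)) // geq_max (leq_trans sq) //=.
  by rewrite (leq_trans (size_scale_leq _ _)) // size_rising.
have bE y t : (b t).[y] = \prod_(i < t) (y + i%:R).
  rewrite horner_prod; apply: eq_bigr => i _.
  by rewrite hornerD hornerX hornerC.
have bS : (b s.+1).[x] - (b s.+1).[x - 1] = s.+1%:R * (b s).[x].
  rewrite !bE big_ord_recr [X in _ - X]big_ord_recl /= addr0.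
  have -> : \prod_(i < s) (x - 1 + (bump 0 i)%:R) = \prod_(i < s) (x + i%:R).
    apply: eq_bigr => i _.
    by rewrite /bump leq0n add1n -natr1 [i%:R + 1]addrC addrA subrK.
  by rewrite -natr1; ring.
have s0 : (s.+1%:R : rat) != 0 by rewrite pnatr_eq0.
have /(congr1 (fun z => z + p`_s * (b s).[x])) := qE x.
rewrite hornerD hornerN hornerZ subrK => <-; rewrite !hornerD !hornerZ.
transitivity (q.[x] - q.[x - 1] +
  p`_s / s.+1%:R * ((b s.+1).[x] - (b s.+1).[x - 1])); first by ring.
by rewrite bS; move: (s.+1%:R : rat) s0 => z z0; field.
Qed.

(** On a residue class modulo [c] the factor [(1 - X^c)^e] acts as the [e]-fold
    backward difference. *)
Lemma conv_1BXn_poly c e j (f : nat -> rat) N : (0 < c)%N ->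
  (forall n, (N <= n)%N -> conv ((1 - 'X^c) ^+ e) f n = 0) ->
  exists p : {poly rat}, (size p <= e)%N /\ exists M, forall m, (M <= m)%N ->
    f (j + c * m)%N = p.[m%:R].
Proof.
move=> c0; elim: e f => [|e IHe] f fN.
  exists 0; rewrite size_poly0; split=> //; exists N => m Nm.
  have := fN (j + c * m)%N; rewrite expr0 horner0 -(expr0 'X) convXn /= subn0.
  by apply; nia.
have [|p [sp [M fM]]] := IHe (conv (1 - 'X^c) f).
  by move=> n Nn; rewrite -convM -exprSr fN.
have [q [sq qE]] := poly_antidifference sp.
exists (q + (f (j + c * M)%N - q.[M%:R])%:P); split.
  rewrite (leq_trans (size_polyD _ _)) // geq_max sq /=.
  by rewrite (leq_trans (size_polyC_leq1 _)).
exists M => m /subnK <-; elim: (m - M)%N => [|i IHi].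
  by rewrite add0n hornerD hornerC addrC subrK.
have := fM (i.+1 + M)%N (leq_addl _ _).
have E : (c <= j + c * (i.+1 + M))%N by nia.
rewrite conv1BXn E -qE.
have -> : (j + c * (i.+1 + M) - c = j + c * (i + M))%N by nia.
have -> : (i.+1 + M)%:R - 1 = (i + M)%:R :> rat.
  by rewrite addSn -natr1 addrK.
by rewrite IHi !hornerD !hornerC => h; lra.
Qed.

(** Since [1 - X^c] divides [1 - X^(c m)], the factors of the denominator can be
    given a common exponent, which becomes the period. *)
Lemma rat_denom_dvd b : all (fun c => 0 < c)%N b ->
  exists T, (1 - 'X^(\prod_(c <- b) c)) ^+ size b = T * rat_denom b.
Proof.
have dvd (c m : nat) : exists T : {poly rat}, 1 - 'X^(c * m) = T * (1 - 'X^c).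
  exists (\sum_(i < m) 'X^c ^+ i); rewrite exprM.
  by rewrite mulrC -opprB subrX1 -mulNr opprB.
have pw (x : seq nat) P : exists T : {poly rat},
  \prod_(c <- x) (1 - 'X^(c * P c)%N) = T * rat_denom x.
  elim: x => [|c x [T IH]].
    by exists 1; rewrite /rat_denom !big_nil mulr1.
  have [U E] := dvd c (P c); exists (U * T).
  by rewrite /rat_denom !big_cons IH E /rat_denom; ring.
move=> b0; pose P c := ((\prod_(a <- b) a) %/ c)%N.
have [T TE] := pw b P; exists T; rewrite -TE.
rewrite -[LHS]iter_mulr_1 -(count_predT b) -big_const_seq.
rewrite big_seq [RHS]big_seq; apply: eq_bigr => c cb; congr (1 - 'X^_).
by rewrite mulnC divnK // (big_rem c) //= dvdn_mulr.
Qed.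


(** The leading term of a polynomial dominates along the natural numbers. *)
Lemma size_poly_growth (p : {poly rat}) (C : rat) d N :
  (forall m : nat, (N <= m)%N -> `|p.[m%:R]| <= C * m.+1%:R ^+ d) ->
  (size p <= d.+1)%N.
Proof.
move=> pC; rewrite leqNgt; apply/negP => dp.
have [e sp] : exists e, size p = e.+2 by exists (size p).-2; lia.
have de : (d <= e)%N by lia.
pose S := \sum_(i < e.+1) `|p`_i|.
have a0 : 0 < `|lead_coef p|.
  by rewrite normr_gt0 lead_coef_eq0 -size_poly_eq0 sp.
have C0 : 0 <= C.
  have := le_trans (normr_ge0 _) (pC N (leqnn N)).
  by rewrite pmulr_lge0 // exprn_gt0.
pose K : rat := (C * 2 ^+ d + S) / `|lead_coef p|.
pose m := maxn (maxn N 1) (Num.truncn K).+1.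
have mK : K < m%:R.
  apply: lt_le_trans (truncnS_gt K) _; rewrite ler_nat; exact: leq_maxr.
have m1 : 1 <= m%:R :> rat by rewrite ler1n /m; lia.
have Nm : (N <= m)%N by rewrite /m; lia.
apply/negP: (pC m Nm).
rewrite -ltNge; move: mK; rewrite ltr_pdivrMr // => mK.
have me : 0 < (m%:R : rat) ^+ e by rewrite exprn_gt0 // (lt_le_trans _ m1).
have lower : `|\sum_(i < e.+1) p`_i * m%:R ^+ i| <= S * m%:R ^+ e.
  rewrite (le_trans (ler_norm_sum _ _ _)) // mulr_suml ler_sum // => i _.
  rewrite normrM ler_wpM2l // ger0_norm ?exprn_ge0 ?(le_trans _ m1) //.
  by rewrite ler_weXn2l //; have := ltn_ord i; lia.
have upper : C * m.+1%:R ^+ d <= C * 2 ^+ d * m%:R ^+ e.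
  rewrite -mulrA ler_wpM2l //.
  have /le_trans -> // : (m.+1%:R : rat) ^+ d <= (2 * m%:R) ^+ d.
    by rewrite lerXn2r ?nnegrE // ?mulr_ge0 // -natr1; lra.
  by rewrite exprMn ler_wpM2l ?exprn_ge0 // ler_weXn2l.
rewrite horner_coef sp big_ord_recr /= (le_lt_trans upper) //.
have := lerB_normD (p`_e.+1 * m%:R ^+ e.+1) (\sum_(i < e.+1) p`_i * m%:R ^+ i).
rewrite addrC normrM; apply: lt_le_trans.
have -> : `|p`_e.+1| = `|lead_coef p| by rewrite lead_coefE sp.
rewrite [`|m%:R ^+ _|]ger0_norm ?exprn_ge0 ?(le_trans _ m1) // exprS.
rewrite ltrBrDr (le_lt_trans (lerD (lexx _) lower)) //.
by rewrite -mulrDl mulrA ltr_pM2r // [_ * m%:R]mulrC.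
Qed.

(** The exponent of the denominator only gives a crude bound for the degree of
    the polynomials on the residue classes; the growth of the sequence gives the
    bound [d]. *)
Lemma rat_gf_quasi_polynomial d (f : nat -> rat) (C : rat) N : rat_gf f ->
  (forall n, (N <= n)%N -> `|f n| <= C * n.+1%:R ^+ d) ->
  exists g, quasi_polynomial_deg_le d g /\
    exists M, forall n, (M <= n)%N -> f n = g n.
Proof.
move=> [b [N' [b0 fN']]] fC; have [T TE] := rat_denom_dvd b0.
move: TE; set c := \prod_(c <- b) c => TE.
have c0 : (0 < c)%N.
  by rewrite /c big_seq; apply: prodn_cond_gt0 => i /(allP b0).
have C0 : 0 <= C.
  have := le_trans (normr_ge0 _) (fC N (leqnn N)).
  by rewrite pmulr_lge0 // exprn_gt0.
have cvf n : (N' + size T <= n)%N -> conv ((1 - 'X^c) ^+ size b) f n = 0.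
  by move=> nT; rewrite TE convM (@conv_eventually0 _ _ N').
have P j : exists pM : {poly rat} * nat, (j < c)%N ->
    (size pM.1 <= d.+1)%N /\
    forall m, (pM.2 <= m)%N -> f (j + c * m)%N = pM.1.[m%:R].
  have [p [_ [M fM]]] := conv_1BXn_poly j c0 cvf.
  exists (p, M) => jc; split=> //=.
  apply: (@size_poly_growth _ (C * c%:R ^+ d) _ (maxn N M)) => m mN.
  rewrite -fM; last by lia.
  apply: le_trans (fC _ _) _; first by nia.
  rewrite -mulrA -exprMn -natrM ler_wpM2l // lerXn2r ?nnegrE ?ler0n //.
  by rewrite ler_nat; nia.
have [pM pME] := choice P.
pose u j : {poly rat} := (pM j).1 \Po (c%:R^-1 *: ('X - j%:R%:P)).
exists (fun n => (u (n %% c)%N).[n%:R]); split.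
  exists c, u; split=> // j jc; have [sp _] := pME j jc.
  rewrite (leq_trans (size_comp_poly_leq _ _)) //.
  rewrite size_scale ?invr_eq0 ?pnatr_eq0 -?lt0n // size_XsubC.
  by move: sp; case: (size _) => // s; rewrite muln1.
exists (c * \max_(j < c) (pM j).2 + c)%N => n nM.
have nc : (n %% c < c)%N by rewrite ltn_mod.
have [_ pE] := pME _ nc.
have -> : (u (n %% c)%N).[n%:R] = (pM (n %% c)%N).1.[(n %/ c)%:R].
  rewrite /u horner_comp; congr (horner _ _).
  rewrite !hornerE {1}(divn_eq n c) natrD natrM addrK mulrC mulfK //.
  by rewrite pnatr_eq0 -lt0n.
rewrite {1}(divn_eq n c) addnC mulnC pE //.
have := leq_bigmax (F := fun j : 'I_c => (pM j).2) (Ordinal nc); move=> /= le.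
apply: leq_trans le _; rewrite leq_divRL // mulnC.
exact: leq_trans (leq_addr _ _) nM.
Qed.
(** * Counting outside a monomial ideal *)

(** Dickson's lemma. Once a finite set [B] works for the coordinates other
    than [i], the elements whose [i]-th coordinate is at least the maximum of
    that coordinate on [B] need nothing more, and the other elements lie in
    finitely many slices on which the coordinate [i] is constant. *)
Lemma dickson (T : choiceType) (J : eqType) (f : J -> T -> nat) (s : seq J)
    (S : T -> Prop) :
  exists B : seq T, (forall b, b \in B -> S b) /\
    forall x, S x ->
      exists2 b, b \in B & forall j, j \in s -> (f j b <= f j x)%N.
Proof.
elim: s S => [|i s IHs] S.
  have [[x Sx]|nS] := EM (exists x, S x); last first.
    by exists [::]; split=> // x Sx; case: nS; exists x.
  exists [:: x]; split=> [b|y _]; first by rewrite inE => /eqP ->.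
  by exists x; rewrite ?inE.
have [B [BS BP]] := IHs S.
have [Bk BkP] := choice (fun k => IHs (fun x => S x /\ f i x = k)).
pose K := \max_(b <- B) f i b.
exists (B ++ flatten [seq Bk k | k <- iota 0 K]); split=> [b|x Sx].
  rewrite mem_cat => /orP[/BS //|/flattenP[c /mapP[k _ ->] bc]].
  by have [/(_ _ bc)[]] := BkP k.
case: (leqP K (f i x)) => Kx.
  have [b bB bx] := BP _ Sx; exists b; first by rewrite mem_cat bB.
  move=> j; rewrite inE => /predU1P[->|/bx //].
  by apply: leq_trans Kx; rewrite /K; apply: leq_bigmax_seq.
have [BkS /(_ x)[//|b bB bx]] := BkP (f i x).
exists b.
  rewrite mem_cat; apply/orP; right; apply/flattenP; exists (Bk (f i x)) => //.
  by apply/mapP; exists (f i x); rewrite ?mem_iota.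
by move=> j; rewrite inE => /predU1P[->|/bx //]; have [_ ->] := BkS _ bB.
Qed.

Section UpperSets.
Variable r : nat.
Implicit Types (U : 'X_{1..r} -> Prop) (u v : 'X_{1..r}).

Definition upper_set U := forall u v, U u -> U (u + v)%MM.

Lemma upper_set_le U u v : upper_set U -> (u <= v)%MM -> U u -> U v.
Proof. by move=> Uup /submK <- /Uup; rewrite addmC; apply. Qed.

(** Upper sets satisfy the ascending chain condition: the union of a chain is
    an upper set with a finite set of minimal elements, which lie in one member
    of the chain. *)
Lemma upper_set_ind (Q : ('X_{1..r} -> Prop) -> Prop) :
  (forall U, upper_set U ->
     (forall U', upper_set U' -> (forall u, U u -> U' u) ->
        (exists2 u, U' u & ~ U u) -> Q U') -> Q U) ->
  forall U, upper_set U -> Q U.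
Proof.
move=> step U Uup; have [//|nQ] := EM (Q U).
pose bad := {U | upper_set U /\ ~ Q U}.
have larger (W : bad) : exists W' : bad, (forall u, sval W u -> sval W' u) /\
    exists2 u, sval W' u & ~ sval W u.
  case: W => W [Wup nW] /=.
  have [//|noW] := EM (exists W' : bad, (forall u, W u -> sval W' u) /\
    exists2 u, sval W' u & ~ W u).
  case: nW; apply: step => // W' W'up WW' W'W; have [//|nW'] := EM (Q W').
  by case: noW; exists (exist _ W' (conj W'up nW')).
have [next nextP] := choice larger.
pose chain k := sval (iter k next (exist _ U (conj Uup nQ))).
have chain_le k l u : (k <= l)%N -> chain k u -> chain l u.
  move=> /subnK <-; elim: (l - k)%N => [//|m IHm] /IHm.
  by have [+ _] := nextP (iter (m + k) next (exist _ U (conj Uup nQ))); apply.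
have [B [BU BP]] := dickson (fun (i : 'I_r) u => u i) (enum 'I_r)
  (fun u => exists k, chain k u).
have [K KP] : exists K, forall b, b \in B -> chain K b.
  elim: B BU {BP} => [|b B IHB] BU; first by exists 0%N.
  have [|K KB] := IHB; first by move=> c cB; apply: BU; rewrite inE cB orbT.
  have [k kb] := BU b (mem_head _ _); exists (maxn k K) => c.
  rewrite inE => /predU1P[->|/KB].
    by apply: chain_le kb; apply: leq_maxl.
  by apply: chain_le; apply: leq_maxr.
have [_ [u Ku []]] := nextP (iter K next (exist _ U (conj Uup nQ))).
have [|b /KP Kb bu] := BP u; first by exists K.+1.
apply: (upper_set_le _ _ Kb); last by apply/mnm_lepP => i; rewrite bu ?mem_enum.
by rewrite /chain; case: (iter _ _ _) => ? [].
Qed.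

Variable w : 'I_r -> nat.
Hypothesis w0 : forall i, (0 < w i)%N.

Definition weight u := (\sum_i w i * u i)%N.

Lemma weightD u v : weight (u + v) = (weight u + weight v)%N.
Proof.
by rewrite -big_split; apply: eq_bigr => i _; rewrite mnmDE mulnDr.
Qed.

Lemma weight1 i : weight U_(i) = w i.
Proof.
rewrite /weight (bigD1 i) //= mnm1E eqxx muln1 big1 ?addn0 // => j ji.
by rewrite mnm1E eq_sym (negbTE ji) muln0.
Qed.

Lemma mdeg_le_weight u : (mdeg u <= weight u)%N.
Proof. by rewrite mdegE; apply: leq_sum => i _; apply: leq_pmull. Qed.

Definition of_weight n : seq 'X_{1..r} :=
  map val [seq u : 'X_{1..r < n.+1} <- enum {: 'X_{1..r < n.+1}} |
    weight (val u) == n].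

Lemma mem_of_weight n u : (u \in of_weight n) = (weight u == n).
Proof.
apply/mapP/idP => [[v]|un]; first by rewrite mem_filter => /andP[? _] ->.
have un1 : (mdeg u < n.+1)%N by rewrite ltnS -(eqP un) mdeg_le_weight.
by exists (BMultinom un1); rewrite // mem_filter un mem_enum.
Qed.

Lemma of_weight_uniq n : uniq (of_weight n).
Proof.
rewrite map_inj_uniq; last exact: val_inj.
by rewrite filter_uniq // enum_uniq.
Qed.

Definition outside_count U n : rat :=
  (count (fun u => ~~ `[< U u >]) (of_weight n))%:R.

(** The monomials outside [U] are split according to whether they are
    divisible by the variable [j]. *)
Lemma outside_count_split U j n :
  outside_count U n = outside_count (fun u => U u \/ u j <> 0%N) n +
    conv 'X^(w j) (outside_count (fun u => U (u + U_(j))%MM)) n.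
Proof.
rewrite convXn /outside_count -!size_filter.
set s := [seq u <- _ | _].
rewrite -(count_predC (fun u => u j == 0%N) s) natrD -!size_filter.
congr (_ + _).
  rewrite -filter_predI; congr (size _)%:R; apply: eq_filter => u /=.
  apply/andP/asboolPn => [[/eqP u0 /asboolPn nU] []//|nU].
  split; last by apply/asboolPn => Uu; apply: nU; left.
  by apply/eqP; have [//|u0] := EM (u j = 0%N); case: nU; right.
case: ifP => jn; last first.
  rewrite size_filter (eq_in_count (a2 := pred0)) ?count_pred0 // => u.
  rewrite mem_filter mem_of_weight => /andP[_ /eqP un] /=.
  apply/negbTE; rewrite negbK; apply: contraFT jn => u0.
  by rewrite -un /weight (bigD1 j) //= -lt0n in u0 *; nia.
congr (_%:R); rewrite -[RHS](size_map (fun u => (u + U_(j))%MM)).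
apply: perm_size.
apply: uniq_perm.
- by rewrite !filter_uniq ?of_weight_uniq.
- rewrite map_inj_in_uniq ?filter_uniq ?of_weight_uniq //.
  by move=> u v _ _; apply: addIm.
move=> u; rewrite mem_filter mem_filter mem_of_weight /=; apply/idP/mapP.
  move=> /and3P[u0 /asboolPn nU /eqP un].
  have uE : (u - U_(j) + U_(j))%MM = u by rewrite submK // lep1mP.
  exists (u - U_(j))%MM; rewrite ?uE // mem_filter mem_of_weight uE.
  rewrite -uE weightD weight1 in un.
  by apply/andP; split; [apply/asboolPn | lia].
move=> [v]; rewrite mem_filter mem_of_weight => /andP[nU /eqP vn] ->.
rewrite nU weightD weight1 vn subnK // eqxx !andbT.
by rewrite mnmDE mnm1E eqxx addn1.
Qed.

(** Hilbert-Serre for monomial ideals, by noetherian induction: if a variable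
    is not in [U], the set [U + (x_j)] is larger; either [U : x_j] is larger as
    well or multiplication by [x_j] is injective modulo [U], and then the count
    for [U] is a sum of counts for [U + (x_j)] along steps of length [w j]. *)
Lemma outside_count_rat_gf U : upper_set U -> rat_gf (outside_count U).
Proof.
elim/upper_set_ind: U / => U Uup IH.
have [allU|/existsNP[j nUj]] := EM (forall j : 'I_r, U U_(j)%MM).
  apply: (@rat_gf_eventually0 _ 1) => n n1; rewrite /outside_count.
  rewrite (eq_in_count (a2 := pred0)) ?count_pred0 // => u.
  rewrite mem_of_weight => /eqP un; apply/negbTE; rewrite negbK; apply/asboolP.
  have [j uj] : exists j, u j != 0%N.
    apply/existsP; apply: contraT => /existsPn u0.
    rewrite -un /weight big1 // in n1 => i _.
    by move: (u0 i); rewrite negbK => /eqP ->; rewrite muln0.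
  by apply: (upper_set_le Uup _ (allU j)); rewrite lep1mP.
have U1 : rat_gf (outside_count (fun u => U u \/ u j <> 0%N)).
  apply: IH => [u v [/Uup|uj]||]; [by left | right | by left | ].
    by rewrite mnmDE => /eqP; rewrite addn_eq0 => /andP[/eqP].
  by exists U_(j)%MM => //; right; rewrite mnm1E eqxx.
have U2up : upper_set (fun u => U (u + U_(j))%MM).
  by move=> u v Uu; rewrite -addmA (addmC v) addmA; apply: Uup.
have [U2|/existsNP[u /not_implyP[U2u nUu]]] :=
  EM (forall u, U (u + U_(j))%MM -> U u).
  apply: (rat_gf_antidiff (w0 j)); apply: (rat_gf_eventually (N := 0) _ U1).
  move=> n _; rewrite conv1BXn -convXn.
  rewrite [outside_count U n](outside_count_split _ j).
  rewrite [X in _ + X - _](_ : _ = conv 'X^(w j) (outside_count U) n) ?addrK //.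
  congr (conv _ (outside_count _) n); apply: funext => u; apply: propext.
  by split=> [/U2|/Uup].
apply: (@rat_gf_eventually _ _ 0 (fun n _ => esym (outside_count_split U j n))).
apply: rat_gfD => //; apply: rat_gf_conv; apply: IH => // [v|].
  exact: Uup.
by exists u.
Qed.

End UpperSets.

(** * Finitely generated submonoids *)

Section NatSpan.
Variable V : zmodType.
Implicit Types (s : seq V) (v : V) (D A : V -> Prop).

Definition nat_comb s (u : 'X_{1..size s}) : V := \sum_(i < size s) s`_i *+ u i.

Definition nat_span s v := exists u : 'X_{1..size s}, v = nat_comb u.

Lemma nat_combD s (u u' : 'X_{1..size s}) :
  nat_comb (u + u')%MM = nat_comb u + nat_comb u'.
Proof. by rewrite -big_split; apply: eq_bigr => i _; rewrite mnmDE mulrnDr. Qed.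

Lemma nat_span0 s : nat_span s 0.
Proof. by exists 0%MM; rewrite /nat_comb big1 // => i _; rewrite mnm0E. Qed.

Lemma nat_spanD s v v' : nat_span s v -> nat_span s v' -> nat_span s (v + v').
Proof. by move=> [u ->] [u' ->]; exists (u + u')%MM; rewrite nat_combD. Qed.

Lemma nat_span_mem s v : v \in s -> nat_span s v.
Proof.
move=> vs; have ivs : (index v s < size s)%N by rewrite index_mem.
exists (U_(Ordinal ivs))%MM; rewrite /nat_comb (bigD1 (Ordinal ivs)) //=.
rewrite mnm1E eqxx nth_index // big1 ?addr0 // => j ji.
by rewrite mnm1E eq_sym (negbTE ji).
Qed.

Lemma nat_span_ind s (P : V -> Prop) :
  P 0 -> (forall v v', P v -> P v' -> P (v + v')) ->
  (forall v, v \in s -> P v) -> forall v, nat_span s v -> P v.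
Proof.
move=> P0 PD Ps v [u ->]; apply: big_ind => // i _.
elim: (u i) => [|m IHm]; first by rewrite mulr0n.
by rewrite mulrS; apply: PD => //; apply: Ps; apply: mem_nth.
Qed.

Definition fin_gen D := exists s, forall v, D v <-> nat_span s v.

(** Gordan's lemma. The pairs of coefficient vectors of one element in two
    generating systems are the natural solutions of a homogeneous linear
    system; a solution minus a smaller solution is a solution, so the minimal
    nonzero ones generate. *)
Lemma fin_genI D A : fin_gen D -> fin_gen A -> fin_gen (fun v => D v /\ A v).
Proof.
move=> [s sP] [t tP].
pose T := ('X_{1..size s} * 'X_{1..size t})%type.
pose coord (j : 'I_(size s) + 'I_(size t)) (x : T) :=
  match j with inl i => x.1 i | inr i => x.2 i end.
pose W (x : T) := nat_comb x.1 = nat_comb x.2.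
pose size2 (x : T) := (mdeg x.1 + mdeg x.2)%N.
have [B [BW BP]] := dickson coord (enum {: 'I_(size s) + 'I_(size t)})
  (fun x => W x /\ (0 < size2 x)%N).
exists [seq nat_comb x.1 | x <- B] => v; split; last first.
  move: v; apply: nat_span_ind => [|x y|x /mapP[[a b] /BW[Wab _] ->] /=].
  - by split; [apply/sP | apply/tP]; apply: nat_span0.
  - by move=> [/sP Dx /tP Ax] [/sP Dy /tP Ay]; split; [apply/sP|apply/tP];
      apply: nat_spanD.
  by split; [apply/sP; exists a | apply/tP; exists b].
move=> [/sP[a ->] /tP[b ab]].
have [m] := ubnP (size2 (a, b)); elim: m a b ab => // m IHm a b ab ltm.
have [ab0|ab0] := posnP (size2 (a, b)).
  have /eqP : mdeg a = 0%N by move: ab0; rewrite /size2 /=; lia.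
  rewrite mdeg_eq0 => /eqP ->; rewrite /nat_comb big1 => [|i _].
    exact: nat_span0.
  by rewrite mnm0E.
have [//|[a' b'] Bab le] := BP (a, b).
have [Wab' ab'0] := BW _ Bab.
have la : (a' <= a)%MM.
  by apply/mnm_lepP => i; apply: (le (inl i)); rewrite mem_enum.
have lb : (b' <= b)%MM.
  by apply/mnm_lepP => i; apply: (le (inr i)); rewrite mem_enum.
have E := submK la; have F := submK lb.
rewrite -E nat_combD; apply: nat_spanD; last first.
  by apply: nat_span_mem; apply/mapP; exists (a', b').
apply: (IHm _ (b - b')%MM).
  apply: (addIr (nat_comb a')); rewrite -nat_combD E ab -{1}F nat_combD.
  by rewrite -[nat_comb b']/(nat_comb (a', b').2) -Wab'.
move: ltm ab'0; rewrite /size2 /= -{1}E -{1}F !mdegD; lia.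
Qed.

Variable deg : {additive V -> int}.

Definition pos_graded D := forall v, D v -> v != 0 -> 0 < deg v.

(** Among the coefficient vectors of an element of [D] there is a least one for
    the degree-lexicographic order; the vectors that are not least in this sense
    form an upper set, since the order is compatible with addition. So the
    elements of [D] of degree [n] are counted by the monomials outside an upper
    set. *)
Lemma rat_gf_fin_gen D (E : nat -> seq V) : fin_gen D -> pos_graded D ->
  (forall n, uniq (E n)) ->
  (forall n v, v \in E n <-> D v /\ deg v = n%:Z) ->
  rat_gf (fun n => (size (E n))%:R).
Proof.
move=> [s0 s0P] Dpos Euniq EP.
pose s : seq V := [seq v <- s0 | v != 0].
have sP v : D v <-> nat_span s v.
  rewrite s0P; split; move: v; apply: nat_span_ind => [|x y|x xs].
  - exact: nat_span0.
  - exact: nat_spanD.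
  - have [->|x0] := eqVneq x 0; first exact: nat_span0.
    by apply: nat_span_mem; rewrite mem_filter x0.
  - exact: nat_span0.
  - exact: nat_spanD.
  by apply: nat_span_mem; move: xs; rewrite mem_filter => /andP[].
pose w (i : 'I_(size s)) := absz (deg (s`_i)).
have wE (i : 'I_(size s)) : deg (s`_i) = (w i)%:Z /\ (0 < w i)%N.
  have si : s`_i \in s by apply: mem_nth.
  have : 0 < deg (s`_i).
    apply: Dpos; first by apply/sP; apply: nat_span_mem.
    by move: si; rewrite mem_filter => /andP[].
  by rewrite /w => si0; split; lia.
have w0 i : (0 < w i)%N by have [] := wE i.
have degE (u : 'X_{1..size s}) : deg (nat_comb u) = (weight w u)%:Z.
  rewrite raddf_sum /weight -[RHS]/(Posz _) (big_morph Posz PoszD (erefl _)).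
  by apply: eq_bigr => i _; have [e _] := wE i; rewrite raddfMn /= e; lia.
pose least (u : 'X_{1..size s}) :=
  forall u', nat_comb u' = nat_comb u -> (u <= u')%O.
have notleast_up : upper_set (fun u => ~ least u).
  move=> u v /existsNP[u' /not_implyP[uu' /negP]].
  rewrite -ltNge => ltu lst.
  have /lst : nat_comb (u' + v)%MM = nat_comb (u + v)%MM.
    by rewrite !nat_combD uu'.
  by rewrite lemc_add2l leNgt ltu.
have ex_least (u : 'X_{1..size s}) :
    exists2 v : 'X_{1..size s}, nat_comb v = nat_comb u & least v.
  elim: u / (@ltom_wf (size s) u) => u _ IH.
  have [|/existsNP[u' /not_implyP[uu' /negP]]] := EM (least u).
    by exists u.
  by rewrite -ltNge => /IH[v vu' lv]; exists v; rewrite ?vu'.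
apply: (rat_gf_eventually (N := 0) _ (outside_count_rat_gf w0 notleast_up)).
move=> n _; rewrite /outside_count -size_filter; congr (_%:R).
rewrite -(size_map (@nat_comb s)); apply: perm_size; apply: uniq_perm => //.
  rewrite map_inj_in_uniq ?filter_uniq ?of_weight_uniq // => u v.
  rewrite !mem_filter => /andP[/asboolPn/contrapT lu _].
  move=> /andP[/asboolPn/contrapT lv _] uv; apply: le_anti.
  by rewrite lu // lv.
move=> v; apply/mapP/idP => [[u]|/EP[/sP[u ->] un]].
  rewrite mem_filter mem_of_weight // => /andP[_ /eqP un] ->.
  by apply/EP; rewrite degE un; split=> //; apply/sP; exists u.
have [u' uu' lu] := ex_least u; exists u' => //.
rewrite mem_filter mem_of_weight //; apply/andP; split.
  by apply/asboolPn => /(_ lu).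
by rewrite -uu' degE in un; case: un => ->.
Qed.

(** The dependence on the first membership is linear in its truth value, and a
    sum over the members is a sum over an intersection. *)
Lemma rat_gf_sum_membership (J : Type) (A : J -> V -> Prop) (l : seq J)
    (g : seq bool -> rat) D (E : nat -> seq V) :
  (forall j, fin_gen (A j)) -> fin_gen D -> pos_graded D ->
  (forall n, uniq (E n)) ->
  (forall n v, v \in E n <-> D v /\ deg v = n%:Z) ->
  rat_gf (fun n => \sum_(v <- E n) g [seq `[< A j v >] | j <- l]).
Proof.
move=> Afg; elim: l g D E => [|j l IHl] g D E Dfg Dpos Euniq EP.
  apply: (@rat_gf_eventually (fun n => g [::] * (size (E n))%:R) _ 0).
    by move=> n _ /=; rewrite big_const_seq count_predT iter_addr_0 mulr_natr.
  exact/rat_gfZ/(rat_gf_fin_gen Dfg).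
pose gF bs := g (false :: bs); pose gT bs := g (true :: bs) - gF bs.
have := IHl gT (fun v => D v /\ A j v)
  (fun n => [seq v <- E n | `[< A j v >]]) _ _ _ _.
move=> /(_ (fin_genI Dfg (Afg j)) (fun v Dv => Dpos v Dv.1)).
case=> [n|n v|b [N]].
- exact: filter_uniq.
- rewrite mem_filter; split=> [/andP[/asboolP Ajv /EP[]] //|[[Dv Ajv] vn]].
  by apply/andP; split; [apply/asboolP | apply/EP].
move=> h; have {h} : rat_gf (fun n =>
    \sum_(v <- [seq v <- E n | `[< A j v >]]) gT [seq `[< A j' v >] | j' <- l]).
  by exists b, N.
move=> /(rat_gfD (IHl gF D E Dfg Dpos Euniq EP)).
apply: (@rat_gf_eventually _ _ 0) => n _.
rewrite big_filter [X in _ + X]big_mkcond -big_split; apply: eq_bigr => v _ /=.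
by case: ifP; rewrite /gT /gF ?addr0 // addrC subrK.
Qed.

End NatSpan.

(** * Koszul cochains *)

Section Koszul.
Variable R : comNzRingType.
Implicit Types (xs ys : seq R) (F G : seq bool).

(** The Koszul complex of [x :: xs] is the cone of multiplication by [x] on the
    Koszul complex of [xs]. A cochain is a function of subsets, given by their
    characteristic sequences; its component of degree [p] consists of its
    values at the sequences with [p] entries [true]. *)
Fixpoint koszul_d (M : lmodType R) xs (c : seq bool -> M) F : M :=
  match xs, F with
  | x :: xs', b :: F' =>
      if b then x *: c (false :: F') - koszul_d xs' (fun G => c (true :: G)) F'
      else koszul_d xs' (fun G => c (false :: G)) F'
  | _, _ => 0
  end.

Fixpoint koszul_wt ys F : R :=
  match ys, F with
  | y :: ys', b :: F' => (if b then y else 1) * koszul_wt ys' F'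
  | _, _ => 1
  end.

Definition card_true F := count id F.

Variables M N : lmodType R.
Implicit Types c u : seq bool -> M.

Lemma eq_koszul_d xs c c' F :
  (forall G, size G = size F -> (card_true G).+1 = card_true F -> c G = c' G) ->
  koszul_d xs c F = koszul_d xs c' F.
Proof.
elim: xs F c c' => [|x xs IH] [|[] F] c c' cc' //=.
  rewrite cc' //; congr (_ - _); apply: IH => G sG cG.
  by apply: cc'; rewrite /= ?sG //= -cG.
by apply: IH => G sG cG; apply: cc'; rewrite /= ?sG.
Qed.

Lemma koszul_d_linear (f : {linear M -> N}) xs c F :
  f (koszul_d xs c F) = koszul_d xs (fun G => f (c G)) F.
Proof.
elim: xs F c => [|x xs IH] [|[] F] c //=; rewrite ?linear0 //.
by rewrite linearB linearZ /= IH.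
Qed.

Lemma koszul_d0 xs F : koszul_d xs (fun _ => 0 : M) F = 0.
Proof. by elim: xs F => [|x xs IH] [|[] F] //=; rewrite IH ?scaler0 ?subrr. Qed.

Lemma koszul_dB xs c c' F :
  koszul_d xs (fun G => c G - c' G) F = koszul_d xs c F - koszul_d xs c' F.
Proof.
elim: xs F c c' => [|x xs IH] [|[] F] c c' //=; rewrite ?subr0 // IH //.
by rewrite scalerBr !opprD !opprK addrACA.
Qed.

Lemma koszul_dD xs c c' F :
  koszul_d xs (fun G => c G + c' G) F = koszul_d xs c F + koszul_d xs c' F.
Proof.
elim: xs F c c' => [|x xs IH] [|[] F] c c' //=; rewrite ?addr0 // IH //.
by rewrite scalerDr opprD addrACA.
Qed.

Lemma koszul_dZ xs a c F :
  koszul_d xs (fun G => a *: c G) F = a *: koszul_d xs c F.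
Proof.
elim: xs F c => [|x xs IH] [|[] F] c //=; rewrite ?scaler0 // IH //.
by rewrite scalerBr !scalerA mulrC.
Qed.

Lemma koszul_dN xs c F : koszul_d xs (fun G => - c G) F = - koszul_d xs c F.
Proof.
rewrite -sub0r -(koszul_d0 xs F) -koszul_dB.
by apply: eq_koszul_d => G _ _; rewrite sub0r.
Qed.

Lemma koszul_d_sum xs l (a : 'I_l -> R) (c : 'I_l -> seq bool -> M) F :
  koszul_d xs (fun G => \sum_r a r *: c r G) F =
  \sum_r a r *: koszul_d xs (c r) F.
Proof.
elim: l a c => [|l IH] a c.
  rewrite big_ord0 -[RHS](koszul_d0 xs F); apply: eq_koszul_d => G _ _.
  by rewrite big_ord0.
rewrite big_ord_recl -IH -koszul_dZ -koszul_dD.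
by apply: eq_koszul_d => G _ _; rewrite big_ord_recl.
Qed.

Lemma koszul_dd xs c F : koszul_d xs (koszul_d xs c) F = 0.
Proof.
elim: xs F c => [|x xs IH] [|[] F] c //=.
by rewrite koszul_dB koszul_dZ IH subr0 subrr.
Qed.

Definition mul_seq xs ys := [seq z.1 * z.2 | z <- zip xs ys].

(** For powers of the variables these morphisms are the transition maps of the
    direct system whose colimit is the Cech complex. *)
Lemma koszul_d_wt xs ys c F : size xs = size ys ->
  koszul_d (mul_seq xs ys) (fun G => koszul_wt ys G *: c G) F =
  koszul_wt ys F *: koszul_d xs c F.
Proof.
elim: xs ys F c => [|x xs IH] [|y ys] [|b F] c //= sxy; rewrite ?scaler0 //.
case: sxy => sxy; case: b => /=.
  rewrite scalerBr; congr (_ - _).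
    by rewrite mul1r !scalerA; congr (_ *: _); ring.
  rewrite -scalerA -IH // -koszul_dZ.
  by apply: eq_koszul_d => G _ _; rewrite scalerA.
rewrite mul1r -IH // -/(mul_seq xs ys).
by apply: eq_koszul_d => G _ _; rewrite mul1r.
Qed.

Lemma koszul_wt0 ys F : card_true F = 0%N -> koszul_wt ys F = 1.
Proof. by elim: ys F => [|y ys IH] [|[] F] //= /IH ->; rewrite mul1r. Qed.

Lemma card_true0 F : card_true F = 0%N -> F = nseq (size F) false.
Proof. by elim: F => [|[] F IH] //= /IH <-. Qed.

Definition killed xs (e : M) := forall x, x \in xs -> x *: e = 0.

(** In degree zero a cochain is an element, and its differential collects its
    multiples by the entries of [xs]. *)
Lemma koszul_d_deg1 xs c :
  (forall F, size F = size xs -> card_true F = 1%N -> koszul_d xs c F = 0) <->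
  killed xs (c (nseq (size xs) false)).
Proof.
elim: xs c => [|x xs IH] c; first by split=> // _ [].
split=> [dc y|kc [|[] F] //= [sF]].
- rewrite inE => /predU1P[->|yxs].
    have := dc (true :: nseq (size xs) false).
    rewrite /= size_nseq /card_true /= count_nseq => /(_ erefl erefl).
    rewrite (@eq_koszul_d xs _ (fun=> 0)) ?koszul_d0 ?subr0 // => G _.
    by rewrite /card_true count_nseq.
  apply: (IH (fun G => c (false :: G))).1 yxs => F sF cF.
  by have := dc (false :: F); rewrite /= sF; apply.
- move=> [/card_true0 ->]; rewrite sF kc ?mem_head // sub0r.
  rewrite (@eq_koszul_d xs _ (fun=> 0)) ?koszul_d0 ?oppr0 // => G _.
  by rewrite /card_true count_nseq.
apply: (IH (fun G => c (false :: G))).2 => // y yxs.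
by apply: kc; rewrite inE yxs orbT.
Qed.

(** The condition dual to regularity of a sequence. *)
Fixpoint coregular xs : Prop :=
  if xs is x :: xs' then
    (forall e : M, killed xs' e -> exists2 e', killed xs' e' & x *: e' = e) /\
    coregular xs'
  else True.

(** For a coregular sequence the Koszul cohomology is concentrated in degree
    zero, by the long exact sequence of the cone: in degree one the class that
    remains is that of an element killed by [xs], which is divisible by [x]. *)
Lemma koszul_exact xs c p : coregular xs ->
  (forall F, size F = size xs -> card_true F = p.+2 -> koszul_d xs c F = 0) ->
  exists u, forall F, size F = size xs -> card_true F = p.+1 ->
    c F = koszul_d xs u F.
Proof.
elim: xs c p => [|x xs IH] c p /=; first by exists (fun=> 0) => -[].
move=> [xdiv cor] dc.
have [u0 u0P] : exists u, forall F, size F = size xs -> card_true F = p.+1 ->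
    c (false :: F) = koszul_d xs u F.
  by apply: IH => // F sF cF; have := dc (false :: F); rewrite /= sF; apply.
pose c1 F := c (true :: F) - x *: u0 F.
have dc1 F : size F = size xs -> card_true F = p.+1 -> koszul_d xs c1 F = 0.
  move=> sF cF; rewrite koszul_dB koszul_dZ -u0P //.
  have := dc (true :: F); rewrite /= sF => /(_ erefl).
  rewrite /card_true /= -/(card_true F) cF => /(_ erefl) /eqP.
  by rewrite subr_eq0 => /eqP ->; rewrite subrr.
case: p => [|p] in dc u0P dc1 *.
  have [e ke xe] := xdiv _ ((koszul_d_deg1 xs c1).1 dc1).
  pose F0 := nseq (size xs) false.
  pose ce F := if F == F0 then e else 0.
  have dce F : size F = size xs -> card_true F = 1%N -> koszul_d xs ce F = 0.
    move: F; apply/koszul_d_deg1; by rewrite /ce eqxx.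
  exists (fun F => if F is false :: F' then u0 F' + ce F' else 0).
  case=> [|[] F] //= [sF].
    move=> [/card_true0]; rewrite sF => FF0; rewrite FF0 koszul_d0 subr0.
    by rewrite /ce eqxx scalerDr xe /c1 addrC subrK.
  by move=> cF; rewrite koszul_dD dce // addr0 -u0P.
have [u1 u1P] := IH c1 p cor dc1.
exists (fun F => if F is b :: F' then if b then - u1 F' else u0 F' else 0).
case=> [|[] F] //= [sF]; last by move=> /(u0P _ sF).
move=> [/(u1P _ sF)]; rewrite /c1 => /eqP; rewrite subr_eq addrC => /eqP ->.
by rewrite koszul_dN opprK.
Qed.

End Koszul.

(** The differential only sees the values at the sequences obtained from [F] by
    turning one entry [true] into [false]. *)
Lemma koszul_d_transport (R R' : comNzRingType) (M : lmodType R)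
    (N : lmodType R') (L : M -> N) (xs : seq R) (ys : seq R')
    (c : seq bool -> M) (c' : seq bool -> N) F :
  size xs = size ys -> size F = size xs ->
  L 0 = 0 -> {morph L : x y / x - y} ->
  (forall j, nth false F j ->
     L (xs`_j *: c (set_nth false F j false)) =
     ys`_j *: c' (set_nth false F j false)) ->
  L (koszul_d xs c F) = koszul_d ys c' F.
Proof.
move=> + + L0 LB; elim: xs ys c c' F => [|x xs IH] [|y ys] c c' [|[] F] //=.
  move=> [sxy] [sF] LF; rewrite LB (LF 0%N) //; congr (_ - _).
  by apply: IH => // j Fj; apply: (LF j.+1).
by move=> [sxy] [sF] LF; apply: IH => // j Fj; apply: (LF j.+1).
Qed.

(** * Monomial ideals and injective modules *)

Section Monomials.
Variables (k : fieldType) (d : nat).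
Local Notation R := {mpoly k[d]}.
Implicit Types (a b : 'X_{1..d}) (f g : R).

Lemma msupp_ideal_gen (S : 'X_{1..d} -> Prop) f b :
  f \in ideal_gen (fun g : R => exists2 a, S a & g = 'X_[a]) -> b \in msupp f ->
  exists2 a, S a & (a <= b)%MM.
Proof.
move=> /asboolP[s [sS ->]] /msupp_sum_le /flattenP[l].
move=> /mapP[p]; rewrite filter_predT => /sS[a Sa ->] -> /msuppM_le.
move=> /allpairsP[[m1 m2] [/= _ /mem_msuppXP <- ->]].
by exists a => //; apply: lem_addl.
Qed.

Lemma mem_monomial_le (I : ideal R) a b :
  (a <= b)%MM -> 'X_[a] \in I -> 'X_[b] \in I.
Proof. by move=> /submK <- aI; rewrite mpolyXD; apply: (rpredZ (_ : R) aI). Qed.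

Lemma mem_msupp_ideal (I : ideal R) f :
  (forall b, b \in msupp f -> 'X_[b] \in I) -> f \in I.
Proof.
move=> fI; rewrite (mpolyE f) big_seq; apply: rpred_sum => b bf.
rewrite -mul_mpolyC; exact: (rpredZ (_ : R) (fI b bf)).
Qed.

Lemma mem_ideal_gen_monomial (S : 'X_{1..d} -> Prop) a :
  S a -> 'X_[a] \in ideal_gen (fun g : R => exists2 a, S a & g = 'X_[a]).
Proof.
move=> Sa; apply/asboolP; exists [:: (1, 'X_[a])]; split.
  by move=> p; rewrite inE => /eqP ->; exists a.
by rewrite big_seq1 mul1r.
Qed.

Lemma mem_monomial_ideal (I : ideal R) f : monomial_ideal I ->
  f \in I <-> forall b, b \in msupp f -> 'X_[b] \in I.
Proof.
move=> [S IS]; split=> [|/mem_msupp_ideal //].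
rewrite IS => fS b /(msupp_ideal_gen fS)[a Sa ab].
apply: (mem_monomial_le ab); rewrite IS; exact: mem_ideal_gen_monomial.
Qed.

End Monomials.

Section Quotient.
Variables (R : comNzRingType) (M : lmodType R) (N : submodClosed M).

Lemma scale_quotmod_pi (r : R) (x : M) :
  r *: quotmod_pi N x = quotmod_pi N (r *: x).
Proof. exact: quotmod_piZ. Qed.

Lemma quotmod_pi0 : quotmod_pi N 0 = 0.
Proof. by apply: (addrI (quotmod_pi N 0)); rewrite -quotmod_piD !addr0. Qed.

Lemma quotmod_pi_eq0 x : quotmod_pi N x = 0 <-> x \in N.
Proof. by rewrite -quotmod_pi0 quotmod_piP subr0. Qed.

Lemma quotmod_pi_sum l (z : 'I_l -> M) :
  \sum_r quotmod_pi N (z r) = quotmod_pi N (\sum_r z r).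
Proof. by rewrite (big_morph _ (@quotmod_piD _ _ N) quotmod_pi0). Qed.

Definition quotmod_repr (u : quotmod N) : M :=
  repr (u : Quotient.quot (submod_zmod N)).

Lemma quotmod_piK u : quotmod_pi N (quotmod_repr u) = u.
Proof. exact: quotmod_reprK. Qed.

Lemma quotmod_repr_pi x : quotmod_repr (quotmod_pi N x) - x \in N.
Proof. by apply/quotmod_piP; rewrite quotmod_piK. Qed.

End Quotient.

Section InjectiveCoregular.
Variables (k : fieldType) (d : nat).
Local Notation R := {mpoly k[d]}.

Definition linear_of (U V : lmodType R) (f : U -> V) (fL : linear f) :
  {linear U -> V} := HB.pack f (GRing.isLinear.Build R U V *:%R f fL).

Definition var_powers t (s : seq 'I_d) : seq R := [seq 'X_j ^+ t | j <- s].

(** An element [e] killed by some powers of variables is the image of [1] under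
    a linear map on the quotient by these powers, on which the power of another
    variable is injective; an extension of the linear map along that injection
    sends [1] to an element that divides [e]. *)
Lemma injective_coregular (E : lmodType R) t (s : seq 'I_d) :
  injective_module E -> uniq s -> coregular E (var_powers t s).
Proof.
move=> Einj; elim: s => //= j s IHs /andP[js us]; split; last exact: IHs.
move=> e ke {IHs us}.
pose S (a : 'X_{1..d}) := exists2 i, i \in s & a = (U_(i) *+ t)%MM.
pose J : ideal R := ideal_gen (fun g : R => exists2 a, S a & g = 'X_[a]).
have JX i : i \in s -> ('X_i ^+ t : R) \in J.
  move=> si; rewrite mpolyXn; apply: mem_ideal_gen_monomial; by exists i.
have kJ f : f \in J -> f *: e = 0.
  move=> /asboolP[l [lS ->]]; rewrite scaler_suml big_seq big1 // => p /lS.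
  move=> [_ [i si ->]] ->; rewrite -scalerA -mpolyXn ke ?scaler0 //.
  by apply/mapP; exists i.
pose A : lmodType R := quotmod J.
have piP (u : A) : exists r : R, u = quotmod_pi J r.
  by exists (quotmod_repr u); rewrite quotmod_piK.
pose h (u : A) : A := ('X_j ^+ t : R) *: u.
have hL : linear h.
  by move=> r u v; rewrite /h scalerDr !scalerA mulrC.
pose f (u : A) : E := (quotmod_repr u : R) *: e.
have fE (r : R) : f (quotmod_pi J r) = r *: e.
  apply/eqP; rewrite /f -subr_eq0 -scalerBl; apply/eqP; apply: kJ.
  exact: quotmod_repr_pi.
have fL : linear f.
  move=> r u v; have [x ->] := piP u; have [y ->] := piP v.
  by rewrite scale_quotmod_pi -quotmod_piD !fE scalerDl scalerA.
have h_inj : injective (linear_of hL).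
  move=> u v; have [x ->] := piP u; have [y ->] := piP v.
  rewrite /= /h !scale_quotmod_pi => /quotmod_piP; rewrite -mulrBr => xyJ.
  apply/quotmod_piP; apply: mem_msupp_ideal => b bxy.
  have [|a [i si ->] ab] := msupp_ideal_gen (b := (U_(j) *+ t + b)%MM) xyJ.
    by rewrite mcoeff_msupp mpolyXn mulrC mcoeffMX -mcoeff_msupp.
  apply: (@mem_monomial_le _ _ _ (U_(i) *+ t)%MM); last by rewrite -mpolyXn JX.
  apply/mnm_lepP => l; move/mnm_lepP: ab => /(_ l).
  rewrite mnmDE !mulmnE !mnm1E; case: (eqVneq i l) => // <-.
  by case: (eqVneq j i) => [ji|_] //; rewrite ji si in js.
have [g gE] := Einj _ _ (linear_of hL) (linear_of fL) h_inj.
exists (g (quotmod_pi J 1)) => [x /mapP[i si ->]|].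
  rewrite -linearZ /= scale_quotmod_pi [_ *: _]mulr1 -(linear0 g); congr (g _).
  by apply/quotmod_pi_eq0; rewrite JX.
by rewrite -linearZ -/(h _) [g _]gE /= fE scale1r.
Qed.

End InjectiveCoregular.

(** * Dimension shifting along an injective resolution *)

Section Independence.
Variables (k : fieldType) (R : comNzRingType) (io : {rmorphism k -> R}).

Definition independent (T : Type) (M : lmodType R) (B : (T -> M) -> Prop)
    l (c : 'I_l -> T -> M) : Prop :=
  forall a : 'I_l -> k, B (fun x => \sum_r io (a r) *: c r x) ->
    forall r, a r = 0.

(** [dim_ge Z B l] says that [Z / (Z :&: B)] has dimension at least [l] over
    [k], for families [Z] and [B] of functions closed under linear
    combinations. *)
Definition dim_ge (T : Type) (M : lmodType R) (Z B : (T -> M) -> Prop) l :=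
  exists c : 'I_l -> T -> M, (forall r, Z (c r)) /\ independent B c.

(** Dimensions are compared along linear relations rather than maps, since the
    connecting morphisms of long exact sequences involve choices. *)
Definition linear_rel (T T' : Type) (M M' : lmodType R)
    (L : (T -> M) -> (T' -> M') -> Prop) :=
  forall l (a : 'I_l -> R) c b, (forall r, L (c r) (b r)) ->
    L (fun x => \sum_r a r *: c r x) (fun x => \sum_r a r *: b r x).

Lemma dim_ge_transfer (T T' : Type) (M M' : lmodType R)
    (Z B : (T -> M) -> Prop) (Z' B' : (T' -> M') -> Prop) L l :
  linear_rel L -> (forall c, Z c -> exists2 b, Z' b & L c b) ->
  (forall c b, L c b -> B' b -> B c) -> dim_ge Z B l -> dim_ge Z' B' l.
Proof.
move=> Llin ZZ' B'B [c [Zc cB]].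
have bex r : exists b, Z' b /\ L (c r) b.
  by have [b Zb Lb] := ZZ' _ (Zc r); exists b.
have [b bP] := choice bex.
exists b; split=> [r|a /B'B Ba]; first by have [] := bP r.
apply: cB; apply: Ba; apply: (Llin _ (fun r => io (a r))) => r.
by have [] := bP r.
Qed.

End Independence.

Section Shift.
Variables (k : fieldType) (d : nat).
Local Notation R := {mpoly k[d]}.
Local Notation dim_ge := (@dim_ge k R (@mpolyC d k)).
Variables (M : lmodType R) (E : injective_resolution M).

Definition powers t : seq R := var_powers k t (enum 'I_d).

Lemma size_powers t : size (powers t) = d.
Proof. by rewrite size_map size_enum_ord. Qed.

Lemma mul_powers t s : mul_seq (powers t) (powers s) = powers (t + s).
Proof.
rewrite /powers /var_powers /mul_seq; elim: (enum 'I_d) => //= j l ->.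
by rewrite exprD.
Qed.

Lemma koszul_d_powers (N : lmodType R) t s (c : seq bool -> N) F :
  koszul_d (powers (t + s)) (fun G => koszul_wt (powers s) G *: c G) F =
  koszul_wt (powers s) F *: koszul_d (powers t) c F.
Proof. by rewrite -mul_powers koszul_d_wt // !size_powers. Qed.

Definition face p F := size F = d /\ card_true F = p.

Lemma face0 : face 0 (nseq d false).
Proof. by split; rewrite ?size_nseq // /card_true count_nseq. Qed.

Lemma face_lt q F G : face q.+1 F -> size G = size F ->
  (card_true G).+1 = card_true F -> face q G.
Proof.
move=> [sF cF] sG cG; split; first by rewrite sG.
by move: cG; rewrite cF => -[].
Qed.

Lemma koszul_d_face0 (N : lmodType R) t (c : seq bool -> N) F :
  face 0 F -> koszul_d (powers t) c F = 0.
Proof.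
move=> [_ F0]; rewrite -[RHS](koszul_d0 N (powers t) F).
by apply: eq_koszul_d => G _; rewrite F0.
Qed.

Lemma res_dd q x : res_d E q.+1 (res_d E q x) = 0.
Proof. by apply/res_exactS; exists x. Qed.

(** The classes of degree [p] in the colimit over [t] of the Koszul
    cohomology of [M], for the transition maps given by [koszul_wt]. *)
Definition koszul_cocycle t p (c : seq bool -> M) : Prop :=
  forall F, face p.+1 F -> koszul_d (powers t) c F = 0.

Definition koszul_coboundary t p (c : seq bool -> M) : Prop :=
  exists s u, forall F, face p F ->
    koszul_wt (powers s) F *: c F = koszul_d (powers (t + s)) u F.

(** The same classes for the [q]-th cosyzygy of [M], that is, the kernel of
    [res_d E q]. In degree [0] the elements that come from the torsion of the
    previous injective module are also boundaries. *)
Definition syzygy_cocycle t p q (c : seq bool -> E q) : Prop :=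
  (forall F, face p.+1 F -> koszul_d (powers t) c F = 0) /\
  (forall F, face p F -> res_d E q (c F) = 0).

Definition syzygy_coboundary t p q (c : seq bool -> E q) : Prop :=
  if p is p'.+1 then exists s u, (forall F, face p' F -> res_d E q (u F) = 0) /\
    forall F, face p F ->
      koszul_wt (powers s) F *: c F = koszul_d (powers (t + s)) u F
  else c (nseq d false) \in coboundaries (irrelevant_ideal k d) E q.

(** A power of the maximal ideal is contained in the ideal of the [x_j ^ t]: a
    monomial of degree greater than [d t] has an exponent of at least [t]. *)
Lemma killed_torsion (N : lmodType R) (e : N) :
  e \in torsion (irrelevant_ideal k d) N <-> exists t, killed (powers t) e.
Proof.
split=> [/asboolP[t te]|[t te]].
  exists t => _ /mapP[j _ ->]; apply: te.
  elim: t => [|t IHt].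
    by apply/asboolP; exists [:: (1, 1)]; rewrite big_seq1 mul1r; split=> // p;
      rewrite inE => /eqP ->.
  apply/asboolP; exists [:: (1, 'X_j * 'X_j ^+ t)]; split; last first.
    by rewrite big_seq1 mul1r exprS.
  move=> p; rewrite inE => /eqP -> /=; exists 'X_j, ('X_j ^+ t); split=> //.
  apply/asboolP; exists [:: (1, 'X_j)]; rewrite big_seq1 mul1r; split=> // q.
  by rewrite inE => /eqP ->; exists j.
apply/asboolP; exists (d * t).+1 => f If.
have deg n g : g \in ideal_pow (irrelevant_ideal k d) n ->
    forall b, b \in msupp g -> (n <= mdeg b)%N.
  elim: n g => // n IHn g /asboolP[l [lP ->]] b /msupp_sum_le /flattenP[bs].
  move=> /mapP[p]; rewrite filter_predT => /lP[x [y [xI yI ->]]] ->.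
  move=> /msuppM_le /allpairsP[[b1 b2] [/= _ + ->]].
  move=> /msuppM_le /allpairsP[[b3 b4] [/= b3x /(IHn _ yI) b4n ->]].
  rewrite !mdegD; suff : (0 < mdeg b3)%N by lia.
  move: xI => /asboolP[l' [lP' xE]]; move: b3x; rewrite xE.
  move=> /msupp_sum_le /flattenP[bs' /mapP[p']].
  rewrite filter_predT => /lP'[j ->] -> /msuppM_le.
  move=> /allpairsP[[b5 b6] [/= _ /mem_msuppXP <- ->]].
  by rewrite mdegD mdeg1 addn1.
rewrite (mpolyE f) scaler_suml big_seq big1 // => b /(deg _ _ If) bt.
have [j jt] : exists j : 'I_d, (t <= b j)%N.
  apply/existsP; apply: contraLR bt => /existsPn bt; rewrite -leqNgt mdegE.
  rewrite -[X in (_ <= X * _)%N]card_ord -sum_nat_const leq_sum // => j _.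
  by have := bt j; lia.
have -> : b = ((b - U_(j) *+ t) + U_(j) *+ t)%MM.
  rewrite submK //; apply/mnm_lepP => i; rewrite mulmnE mnm1E.
  by case: eqP => [<-|]; rewrite ?mul1n.
rewrite mpolyXD scalerAl -scalerA -mpolyXn te ?scaler0 //.
by apply/mapP; exists j; rewrite ?mem_enum.
Qed.

Lemma koszul_exact_injective (N : lmodType R) t p (c : seq bool -> N) :
  injective_module N ->
  (forall F, face p.+2 F -> koszul_d (powers t) c F = 0) ->
  exists u, forall F, face p.+1 F -> c F = koszul_d (powers t) u F.
Proof.
move=> Ninj dc; have [||u uP] := @koszul_exact _ _ (powers t) c p.
- exact: injective_coregular (enum_uniq _).
- by move=> F; rewrite size_powers => sF cF; apply: dc.
by exists u => F [sF cF]; apply: uP; rewrite ?size_powers.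
Qed.

(** A cochain [u] of [E q] connects a cocycle of the [q]-th cosyzygy with one
    of the next cosyzygy: this is the connecting morphism. *)
Definition connected t p q (c : seq bool -> E q) (b : seq bool -> E q.+1) :
    Prop :=
  exists u : seq bool -> E q,
    (forall F, face p.+1 F -> c F = koszul_d (powers t) u F) /\
    (forall F, face p F -> b F = res_d E q (u F)).

Lemma connected_linear t p q : linear_rel (@connected t p q).
Proof.
move=> l a c b cb; have [u uP] := choice cb.
exists (fun F => \sum_r a r *: u r F); split=> F Fp.
  rewrite koszul_d_sum; apply: eq_bigr => r _.
  by have [-> //] := uP r.
rewrite linear_sum; apply: eq_bigr => r _; rewrite linearZ.
by have [_ ->] := uP r.
Qed.

Lemma connected_l t p q c : syzygy_cocycle t p.+1 c ->
  exists2 b, syzygy_cocycle t p b & @connected t p q c b.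
Proof.
move=> [dc rc]; have [u uP] := koszul_exact_injective (@res_inj _ _ E q) dc.
exists (fun F => res_d E q (u F)); last by exists u.
split=> F Fp; last exact: res_dd.
by rewrite -koszul_d_linear -uP // rc.
Qed.

Lemma connected_r t p q b : syzygy_cocycle t p b ->
  exists2 c, syzygy_cocycle t p.+1 c & @connected t p q c b.
Proof.
move=> [db rb].
have uex F : exists x, face p F -> b F = res_d E q x.
  have [/rb/res_exactS[x xE]|nF] := EM (face p F).
    by exists x.
  by exists 0.
have [u uP] := choice uex.
exists (koszul_d (powers t) u); last by exists u.
split=> F Fp; first exact: koszul_dd.
rewrite koszul_d_linear -(db F Fp); apply: eq_koszul_d => G sG cG.
by rewrite uP //; apply: face_lt Fp sG cG.
Qed.

(** A primitive of [b] lifts to the injective module and corrects [u] to a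
    primitive of [c] in the cosyzygy. In degree zero the primitive is a torsion
    element, which is killed after passing to larger powers of the variables. *)
Lemma connected_coboundary t p q c b : @connected t p q c b ->
  syzygy_coboundary t p b -> syzygy_coboundary t p.+1 c.
Proof.
move=> [u [cu bu]]; case: p => [|p] in cu bu *.
  move=> /asboolP[e /killed_torsion[s ke] be].
  pose ce F := if F == nseq d false then e else 0.
  have dce F : face 1 F -> koszul_d (powers (t + s)) ce F = 0.
    move=> [sF cF]; apply: (koszul_d_deg1 _ _).2 => //; rewrite ?size_powers //.
    rewrite /ce eqxx => _ /mapP[j jd ->]; rewrite exprD -scalerA ke ?scaler0 //.
    by apply/mapP; exists j.
  exists s, (fun F => koszul_wt (powers s) F *: u F - ce F); split=> F Fp.
    rewrite linearB linearZ /= -bu // koszul_wt0; last by case: Fp.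
    case: (Fp) => sF /card_true0; rewrite sF => FE; rewrite FE.
    by rewrite /ce eqxx be scale1r subrr.
  by rewrite koszul_dB dce // subr0 koszul_d_powers -cu.
move=> [s [v [rv bv]]].
have wex F : exists x, face p F -> v F = res_d E q x.
  have [/rv/res_exactS[x xE]|nF] := EM (face p F); first by exists x.
  by exists 0.
have [w wP] := choice wex.
exists s, (fun F =>
  koszul_wt (powers s) F *: u F - koszul_d (powers (t + s)) w F).
split=> F Fp; last by rewrite koszul_dB koszul_dd subr0 koszul_d_powers -cu.
rewrite linearB linearZ /= -bu // bv // koszul_d_linear; apply/eqP.
rewrite subr_eq0; apply/eqP; apply: eq_koszul_d => G sG cG.
by rewrite wP //; apply: face_lt Fp sG cG.
Qed.

(** The difference of the primitives [u] and [v] of [c] is a cocycle with values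
    in an injective module, hence a coboundary; in degree zero it is a torsion
    element instead. *)
Lemma coboundary_connected t p q c b : @connected t p q c b ->
  syzygy_coboundary t p.+1 c -> syzygy_coboundary t p b.
Proof.
move=> [u [cu bu]] [s [v [rv cv]]].
pose z F := koszul_wt (powers s) F *: u F - v F.
have dz F : face p.+1 F -> koszul_d (powers (t + s)) z F = 0.
  by move=> Fp; rewrite koszul_dB koszul_d_powers -cu // cv // subrr.
have rz F : face p F -> res_d E q (z F) = koszul_wt (powers s) F *: b F.
  by move=> Fp; rewrite linearB rv // subr0 linearZ /= bu.
case: p => [|p] in cu bu cv rv dz rz *.
  apply/asboolP; exists (z (nseq d false)).
    apply/killed_torsion; exists (t + s)%N.
    rewrite -[d in nseq d](size_powers (t + s)); apply/koszul_d_deg1 => F sF cF.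
    by apply: dz; split; rewrite // -(size_powers (t + s)).
  by rewrite rz ?koszul_wt0 ?scale1r //; [case: face0 | apply: face0].
have [w wP] := koszul_exact_injective (@res_inj _ _ E q) dz.
exists s, (fun F => res_d E q (w F)); split=> F Fp; first exact: res_dd.
by rewrite -rz // wP // koszul_d_linear.
Qed.

Lemma dim_ge_shift t p q l :
  dim_ge (@syzygy_cocycle t p.+1 q) (@syzygy_coboundary t p.+1 q) l <->
  dim_ge (@syzygy_cocycle t p q.+1) (@syzygy_coboundary t p q.+1) l.
Proof.
split; [apply: (dim_ge_transfer (@connected_linear t p q)) |
        apply: (@dim_ge_transfer _ _ _ _ _ _ _ _ _ _ _
          (fun b c => @connected t p q c b))].
- exact: connected_l.
- exact: connected_coboundary.
- by move=> l' a b c /connected_linear.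
- exact: connected_r.
- by move=> b c /coboundary_connected.
Qed.

Lemma dim_ge_shifts t p q i l : (p + q)%N = i ->
  dim_ge (@syzygy_cocycle t p q) (@syzygy_coboundary t p q) l <->
  dim_ge (@syzygy_cocycle t 0 i) (@syzygy_coboundary t 0 i) l.
Proof.
elim: p q => [|p IHp] q pq; first by case: i / pq.
by rewrite dim_ge_shift; apply: IHp; rewrite -pq addnS.
Qed.

(** A module embeds in the first term of its resolution as the kernel of the
    differential. *)
Lemma dim_ge_augmentation t i l :
  dim_ge (koszul_cocycle t i) (koszul_coboundary t i) l <->
  dim_ge (@syzygy_cocycle t i 0) (@syzygy_coboundary t i 0) l.
Proof.
pose L (c : seq bool -> M) (b : seq bool -> E 0%N) :=
  forall F, face i F -> b F = res_aug E (c F).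
have Llin : linear_rel L.
  move=> l' a c b cb F Fi; rewrite linear_sum; apply: eq_bigr => r _.
  by rewrite linearZ /= cb.
have aug_choice (b : seq bool -> E 0%N) p :
    (forall F, face p F -> res_d E 0 (b F) = 0) ->
    exists c, forall F, face p F -> b F = res_aug E (c F).
  move=> rb; have cex F : exists x, face p F -> b F = res_aug E x.
    have [/rb/res_exact0[x xE]|nF] := EM (face p F); first by exists x.
    by exists 0.
  by have [c cP] := choice cex; exists c.
have raug x : res_d E 0 (res_aug E x) = 0 by apply/res_exact0; exists x.
have face_le (N : lmodType R) t' p (c c' : seq bool -> N) F : face p.+1 F ->
    (forall G, face p G -> c G = c' G) ->
    koszul_d (powers t') c F = koszul_d (powers t') c' F.
  move=> Fp cc'; apply: eq_koszul_d => G sG cG; apply: cc'.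
  exact: face_lt Fp sG cG.
split.
  apply: (dim_ge_transfer Llin) => [c dc|c b cb].
    exists (fun F => res_aug E (c F)) => //; split=> F Fi //.
    by rewrite -koszul_d_linear dc // linear0.
  case: i => [|i] in L Llin cb *.
    move=> /eqP b0; exists 0%N, c => F F0; rewrite koszul_d_face0 //.
    rewrite koszul_wt0; last by case: F0.
    case: (F0) => sF /card_true0; rewrite sF => ->.
    rewrite scale1r; apply: (@res_aug_inj _ _ E).
    by rewrite linear0 -b0 cb //; apply: face0.
  move=> [s [u [/aug_choice[v uv] bu]]]; exists s, v => F Fi.
  apply: (@res_aug_inj _ _ E); rewrite linearZ /= -cb // bu // koszul_d_linear.
  by apply: face_le Fi _ => G /uv.
apply: (@dim_ge_transfer _ _ _ _ _ _ _ _ _ _ _ (fun b c => L c b)).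
- by move=> l' a b c /Llin.
- move=> b [db /aug_choice[c bc]]; exists c => // F Fi.
  apply: (@res_aug_inj _ _ E); rewrite linear0 koszul_d_linear -(db F Fi).
  by apply: face_le Fi _ => G /bc.
move=> b c cb [s [u uP]]; case: i => [|i] in L Llin cb uP *.
  have F0 := face0; have := uP _ F0; rewrite koszul_d_face0 //.
  rewrite koszul_wt0 ?scale1r => [c0|]; last by case: F0.
  by rewrite /= unfold_in cb // c0 linear0.
exists s, (fun F => res_aug E (u F)); split=> F Fi //.
by rewrite cb // -linearZ uP // koszul_d_linear.
Qed.

End Shift.

(** * Length and dimension *)

Section Length.
Variables (k : fieldType) (d : nat).
Local Notation R := {mpoly k[d]}.

Lemma left_kernel l j (b : 'I_l -> 'I_j -> k) : (j < l)%N ->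
  exists2 a : 'I_l -> k, (exists r, a r != 0) &
    forall s, \sum_r a r * b r s = 0.
Proof.
move=> jl; pose A := \matrix_(r, s) b r s.
pose v := nz_row (kermx A).
have v0 : v != 0.
  rewrite nz_row_eq0 -mxrank_eq0 mxrank_ker subn_eq0 -ltnNge.
  exact: leq_ltn_trans (rank_leq_col A) jl.
exists (v 0) => [|s].
  apply/existsP; apply: contraNT v0 => /existsPn v0; apply/eqP/rowP => r.
  by rewrite mxE; apply/eqP; have := v0 r; rewrite negbK.
have /sub_kermxP/matrixP/(_ 0 s) := nz_row_sub (kermx A).
rewrite mxE [RHS]mxE => vA; rewrite -[RHS]vA.
by apply: eq_bigr => r _; rewrite [A r s]mxE.
Qed.

Section Subset.
Variables (M : lmodType R) (P : M -> Prop).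

Definition closed_pred
    (Pc : P 0 /\ forall a u v, P u -> P v -> P (a *: u + v)) : {pred M} :=
  fun x => `[< P x >].

Lemma closed_pred_closed Pc : submod_closed (closed_pred Pc).
Proof.
case: (Pc) => P0 PD.
split=> [|a u v /asboolP Pu /asboolP Pv]; apply/asboolP => //.
exact: PD.
Qed.

HB.instance Definition _ Pc :=
  GRing.isSubmodClosed.Build R M (closed_pred Pc) (closed_pred_closed Pc).

End Subset.

Variable H : lmodType R.

Definition free_vectors l (x : 'I_l -> H) :=
  forall a : 'I_l -> k, \sum_r (a r)%:MP *: x r = 0 -> forall r, a r = 0.

(** Pick an element of each step of the chain: in a linear relation the last
    element with a nonzero coefficient would lie in the previous step. *)
Lemma chain_free l : has_chain H l -> exists x : 'I_l -> H, free_vectors x.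
Proof.
move=> [N NP]; have Nle i j : (i <= j)%N -> (j <= l)%N -> {subset N i <= N j}.
  move=> /subnK <-; elim: (j - i)%N => [_ x //|m IHm ml x /IHm Nx].
  by have [+ _] := NP _ ml; apply; apply: Nx; apply: ltnW.
have xex (r : 'I_l) : exists x, x \in N r.+1 /\ x \notin N r.
  by have [_ [x xN xN']] := NP _ (ltn_ord r); exists x.
have [x xP] := choice xex; exists x => a ax0 r0.
apply/eqP; apply: contraT => r0a.
pose r := [arg max_(r > r0 | a r != 0) (r : nat)].
have [ar rmax] : a r != 0 /\ forall r', a r' != 0 -> (r' <= r)%N.
  by rewrite /r; case: arg_maxnP => // r1 ? ?; split.
have [_ /negP[]] := xP r.
suff : (a r)%:MP *: x r \in N r.
  move=> /(rpredZ ((a r)^-1)%:MP).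
  by rewrite scalerA -mpolyCM mulVf // mpolyC1 scale1r.
rewrite (bigD1 r) //= in ax0; move/eqP: ax0; rewrite addr_eq0 => /eqP ->.
rewrite -scaleN1r; apply: rpredZ.
apply: rpred_sum => r' r'r; have [->|ar'] := eqVneq (a r') 0.
  by rewrite mpolyC0 scale0r rpred0.
have [xr' _] := xP r'; apply: rpredZ; apply: Nle xr'; last by apply: ltnW.
by rewrite ltn_neqAle rmax // andbT.
Qed.

Hypothesis H_torsion : forall x : H, exists t, killed (powers k d t) x.

(** Multiply by the variables one after the other, each time as long as the
    product stays outside [N]; this stops since the elements are torsion. *)
Lemma socle (N : submodClosed H) y : y \notin N ->
  exists2 z, z \notin N & forall j : 'I_d, ('X_j : R) *: z \in N.
Proof.
move=> yN; suff [z zN sz] : exists2 z, z \notin N &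
    forall j : 'I_d, j \in enum 'I_d -> ('X_j : R) *: z \in N.
  by exists z => // j; apply: sz; rewrite mem_enum.
elim: (enum 'I_d) => [|j s [z zN sz]]; first by exists y.
have ex : exists e, ('X_j ^+ e : R) *: z \in N.
  have [t tz] := H_torsion z; exists t; rewrite tz ?rpred0 //.
  by apply/mapP; exists j; rewrite ?mem_enum.
case: (ex_minnP ex) => -[|e] eN emin.
  by rewrite scale1r (negbTE zN) in eN.
exists (('X_j ^+ e : R) *: z); first by apply/negP => /emin; rewrite ltnn.
move=> i; rewrite inE => /predU1P[->|/sz iz].
  by rewrite scalerA -exprS.
by rewrite scalerA mulrC -scalerA; apply: rpredZ.
Qed.

(** A submodule of dimension [j] is enlarged by a socle element of the quotient
    to one of dimension [j.+1]. *)
Lemma free_chain l (x : 'I_l -> H) : free_vectors x -> has_chain H l.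
Proof.
move=> xfree.
suff : forall j, (j <= l)%N -> exists N : nat -> submodClosed H,
    (forall i, (i < j)%N ->
      {subset N i <= N i.+1} /\ exists2 x, x \in N i.+1 & x \notin N i) /\
    exists y : 'I_j -> H, forall u, u \in N j ->
      exists b : 'I_j -> k, u = \sum_r (b r)%:MP *: y r.
  by move=> /(_ l (leqnn l))[N [NP _]]; exists N.
elim=> [|j IHj] jl.
  pose P (u : H) := u = 0.
  have Pc : P 0 /\ forall a u v, P u -> P v -> P (a *: u + v).
    by split=> // a u v -> ->; rewrite scaler0 addr0.
  pose N0 : submodClosed H := closed_pred Pc.
  exists (fun=> N0); split=> //.
  by exists (fun=> 0) => u /asboolP ->; exists (fun=> 0); rewrite big_ord0.
have [N [NP [y yP]]] := IHj (ltnW jl).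
have [r xr] : exists r, x r \notin N j.
  apply: contrapT => /forallNP xN.
  have bex r : exists b : 'I_j -> k, x r = \sum_s (b s)%:MP *: y s.
    by apply: yP; apply/negPn/negP/xN.
  have [b bP] := choice bex; have [a [r ar] ab] := left_kernel b jl.
  have ar0 := xfree a _ r; rewrite ar0 ?eqxx // in ar.
  rewrite (eq_bigr (fun r => \sum_s (a r * b r s)%:MP *: y s)) => [|r' _].
    rewrite exchange_big big1 // => s _; rewrite -scaler_suml.
    by rewrite -(raddf_sum (@mpolyC d k)) /= ab mpolyC0 scale0r.
  rewrite bP scaler_sumr; apply: eq_bigr => s _.
  by rewrite scalerA -mpolyCM.
have [z zN sz] := socle xr.
have fz (f : R) : f *: z - (f@_0%MM)%:MP *: z \in N j.
  rewrite -scalerBl; set g := f - _.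
  have g0 : g@_0%MM = 0 by rewrite mcoeffB mcoeffC eqxx mulr1 subrr.
  rewrite (mpolyE g) scaler_suml big_seq; apply: rpred_sum => b bg.
  have [i bi] : exists i, b i != 0%N.
    apply/existsP; apply: contraTT bg => /existsPn b0.
    suff -> : b = 0%MM by rewrite mcoeff_msupp g0 eqxx.
    by apply/mnmP => i; rewrite mnm0E; apply/eqP; have := b0 i; rewrite negbK.
  rewrite -(submK (m := U_(i)) (m' := b)) ?lep1mP // mpolyXD scalerAl -scalerA.
  exact: rpredZ.
pose P u := exists c : k, u - c%:MP *: z \in N j.
have Pc : P 0 /\ forall a u v, P u -> P v -> P (a *: u + v).
  split; first by exists 0; rewrite mpolyC0 scale0r subrr rpred0.
  move=> a u v [c uc] [c' vc']; pose c0 := (a * c%:MP)@_0%MM.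
  exists (c0 + c').
  have -> : a *: u + v - (c0 + c')%:MP *: z = a *: (u - c%:MP *: z) +
      (v - c'%:MP *: z) + ((a * c%:MP) *: z - c0%:MP *: z).
    rewrite scalerBr scalerA mpolyCD scalerDl.
    by rewrite [RHS](AC (2*2*2) ((1*3)*(6*4)*(2*5))) /= addNr addr0 opprD.
  apply: rpredD; last exact: fz.
  by apply: rpredD => //; apply: rpredZ.
pose N' : submodClosed H := closed_pred Pc.
exists (fun i => if (i <= j)%N then N i else N'); split.
  move=> i; rewrite ltnS; case: (ltngtP i j) => // [ij _|-> _].
    exact: NP.
  split.
    by move=> u uN; apply/asboolP; exists 0; rewrite mpolyC0 scale0r subr0.
  exists z => //; apply/asboolP; exists 1.
  by rewrite mpolyC1 scale1r subrr rpred0.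
exists (fun s => if unlift ord_max s is Some s' then y s' else z) => u.
rewrite ltnn => /asboolP[c /yP[b bE]].
exists (fun s => if unlift ord_max s is Some s' then b s' else c).
rewrite big_ord_recr /= unlift_none; apply/eqP; rewrite -subr_eq; apply/eqP.
rewrite bE; apply: eq_bigr => s _.
have -> : widen_ord (leqnSn j) s = lift ord_max s.
  by apply: val_inj; rewrite /= /bump leqNgt ltn_ord.
by rewrite liftK.
Qed.

End Length.

Section LocalCohomologyLength.
Variables (k : fieldType) (d : nat).
Local Notation R := {mpoly k[d]}.
Local Notation m := (irrelevant_ideal k d).
Variables (M : lmodType R) (E : injective_resolution M) (i : nat).
Local Notation H := (local_cohomology m E i).

Definition cocycle_class (z : submod_type (cocycles m E i)) : H :=
  quotmod_pi (coboundaries_in m E i) z.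

Lemma cocycle_class_surj (x : H) : exists z, x = cocycle_class z.
Proof. by exists (quotmod_repr x); rewrite /cocycle_class quotmod_piK. Qed.

Lemma cocycle_class_eq0 z :
  cocycle_class z = 0 <-> val z \in coboundaries m E i.
Proof. exact: quotmod_pi_eq0. Qed.

Lemma killed_powers_le (N : lmodType R) t t' (e : N) : (t <= t')%N ->
  killed (powers k d t) e -> killed (powers k d t') e.
Proof.
move=> /subnK <- te _ /mapP[j jd ->]; rewrite exprD -scalerA te ?scaler0 //.
by apply/mapP; exists j.
Qed.

Lemma local_cohomology_torsion (x : H) : exists t, killed (powers k d t) x.
Proof.
have [z ->] := cocycle_class_surj x.
have /andP[/killed_torsion[t tz] _] := valP z.
exists t => f ft; rewrite /cocycle_class scale_quotmod_pi.
apply/cocycle_class_eq0; suff -> : f *: z = 0.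
  by rewrite raddf0 (coboundaries_closed m E i).1.
by apply: val_inj; rewrite linearZ raddf0 /= tz.
Qed.

Lemma free_classes l (z : 'I_l -> submod_type (cocycles m E i)) :
  free_vectors (fun r => cocycle_class (z r)) <->
  forall a : 'I_l -> k,
    \sum_r (a r)%:MP *: val (z r) \in coboundaries m E i -> forall r, a r = 0.
Proof.
have sumE (a : 'I_l -> k) : \sum_r (a r)%:MP *: cocycle_class (z r) =
    cocycle_class (\sum_r (a r)%:MP *: z r).
  rewrite /cocycle_class -quotmod_pi_sum; apply: eq_bigr => r _.
  exact: scale_quotmod_pi.
have valE (a : 'I_l -> k) : val (\sum_r (a r)%:MP *: z r) =
    \sum_r (a r)%:MP *: val (z r).
  by rewrite raddf_sum; apply: eq_bigr.
split=> zfree a.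
  by rewrite -valE => az; apply: zfree; rewrite sumE; apply/cocycle_class_eq0.
by rewrite sumE => /cocycle_class_eq0; rewrite valE; apply: zfree.
Qed.

(** Local cohomology is torsion, so a chain of submodules of length [l] amounts
    to [l] independent classes; these become Koszul classes by dimension
    shifting. Finitely many torsion elements are killed by common powers of the
    variables, which is why a single [t] suffices. *)
Lemma local_cohomology_chain l : has_chain H l <->
  exists t, dim_ge (@mpolyC d k) (koszul_cocycle t i : (seq bool -> M) -> Prop)
    (koszul_coboundary t i) l.
Proof.
pose F0 := nseq d false.
have dimE t := iff_trans (dim_ge_augmentation E t i l)
  (dim_ge_shifts E t l (addn0 i)).
split=> [/chain_free[x xfree]|[t /dimE[c [cZ cB]]]]; last first.
  have zP r : c r F0 \in cocycles m E i.
    have [dc rc] := cZ r; apply/andP; split; last by apply/eqP/rc/face0.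
    apply/killed_torsion; exists t.
    rewrite /F0 -[d in nseq d](size_powers k d t).
    by apply/koszul_d_deg1 => F; rewrite size_powers => sF cF; apply: dc.
  pose z r : submod_type (cocycles m E i) := Sub (c r F0) (zP r).
  apply: (free_chain local_cohomology_torsion) (_ : free_vectors
    (fun r => cocycle_class (z r))).
  by apply/free_classes => a az; apply: cB.
have [z zE] := choice (fun r => cocycle_class_surj (x r)).
have zfree : free_vectors (fun r => cocycle_class (z r)).
  move=> a az; apply: xfree; rewrite -[RHS]az; apply: eq_bigr => r _.
  by rewrite zE.
have tex r : exists t, killed (powers k d t) (val (z r)).
  by have /andP[/killed_torsion[t tz] _] := valP (z r); exists t.
have [t tP] := choice tex; pose T := \max_r t r.
exists T; apply/dimE; exists (fun r _ => val (z r)); split=> [r|a].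
  split=> F [sF cF]; last by have /andP[_ /eqP] := valP (z r).
  apply: (koszul_d_deg1 _ (fun=> val (z r))).2; rewrite ?size_powers //.
  by apply: killed_powers_le (tP r); apply: leq_bigmax.
exact: (free_classes z).1 zfree a.
Qed.

End LocalCohomologyLength.

(** * Local cohomology of a monomial quotient, degree by degree *)

Lemma koszul_wt_prod (R : comNzRingType) (ys : seq R) F : size F = size ys ->
  koszul_wt ys F = \prod_(j < size ys) (if nth false F j then ys`_j else 1).
Proof.
elim: ys F => [|y ys IH] [|b F] //= => [_|[sF]]; first by rewrite big_ord0.
by rewrite big_ord_recl IH.
Qed.

Section Degrees.
Variables (k : fieldType) (d : nat).
Local Notation R := {mpoly k[d]}.
Implicit Types (a : {ffun 'I_d -> int}) (b m : 'X_{1..d}) (F : seq bool).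

Lemma nth_powers t (j : 'I_d) : (powers k d t)`_j = 'X_j ^+ t.
Proof. by rewrite (nth_map j) ?nth_ord_enum // size_enum_ord. Qed.

Definition ones t F : 'X_{1..d} := [multinom (t * nth false F i)%N | i < d].

Lemma koszul_wt_powers s F : size F = d ->
  koszul_wt (powers k d s) F = 'X_[ones s F].
Proof.
move=> sF; rewrite koszul_wt_prod size_powers // mpolyXE_id.
apply: eq_bigr => j _; rewrite nth_powers mnmE.
by case: ifP; rewrite ?muln1 ?muln0.
Qed.

Variable I : ideal R.
Hypothesis I_monomial : monomial_ideal I.
Local Notation M := (quotmod I).
Implicit Types (u v : M) (c : seq bool -> M).

(** Coefficients at the monomials outside [I] are well defined on the quotient;
    the others are set to zero. *)
Definition qcoef b u : k :=
  if `[< 'X_[b] \in I >] then 0 else (quotmod_repr u : R)@_b.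

Lemma qcoef_pi b (f : R) : 'X_[b] \notin I -> qcoef b (quotmod_pi I f) = f@_b.
Proof.
move=> bI; rewrite /qcoef; case: asboolP => [bI'|_]; first by rewrite bI' in bI.
apply/eqP; rewrite -subr_eq0 -mcoeffB; apply: contraNT bI => fb.
have /(mem_monomial_ideal _ I_monomial) := quotmod_repr_pi I f; apply.
by rewrite mcoeff_msupp.
Qed.

Lemma qcoef_sum b l (r : 'I_l -> R) (u : 'I_l -> M) :
  qcoef b (\sum_j r j *: u j) = \sum_j qcoef b (r j *: u j).
Proof.
have [bI|bI] := boolP ('X_[b] \in I).
  by rewrite /qcoef asboolT // big1.
under eq_bigr => j _ do rewrite -(quotmod_piK (u j)) scale_quotmod_pi.
rewrite quotmod_pi_sum qcoef_pi // raddf_sum; apply: eq_bigr => j _.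
by rewrite -[in RHS](quotmod_piK (u j)) scale_quotmod_pi qcoef_pi.
Qed.

Lemma qcoefB b u v : qcoef b (u - v) = qcoef b u - qcoef b v.
Proof.
have [bI|bI] := boolP ('X_[b] \in I).
  by rewrite /qcoef asboolT // subrr.
rewrite -(quotmod_piK u) -(quotmod_piK v) -scaleN1r scale_quotmod_pi.
by rewrite -quotmod_piD scaleN1r !qcoef_pi // mcoeffB.
Qed.

Lemma qcoef0 b : qcoef b 0 = 0.
Proof. by rewrite -(subrr 0) qcoefB subrr. Qed.

Lemma qcoefC b (x : k) u : qcoef b (x%:MP *: u) = x * qcoef b u.
Proof.
have [bI|bI] := boolP ('X_[b] \in I).
  by rewrite /qcoef asboolT // mulr0.
rewrite -(quotmod_piK u) scale_quotmod_pi !qcoef_pi //; exact: mcoeffCM.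
Qed.

Lemma qcoefX b m u : 'X_[b] \notin I ->
  qcoef b ('X_[m] *: u) = if (m <= b)%MM then qcoef (b - m)%MM u else 0.
Proof.
move=> bI; rewrite -(quotmod_piK u) scale_quotmod_pi qcoef_pi //.
set f := quotmod_repr u; rewrite -[_ *: _]/('X_[m] * (f : R)) mulrC.
case: ifP => mb; last first.
  apply: memN_msupp_eq0; apply/negP => /msuppM_le /allpairsP[[m1 m2]] [/= _].
  by move=> /mem_msuppXP <- bE; rewrite bE lem_addl in mb.
rewrite qcoef_pi ?(contra _ bI) //.
  by rewrite -{1}(submK mb) addmC mcoeffMX.
by apply: mem_monomial_le; apply: lem_subr.
Qed.

Lemma qcoef_eq0 u : (forall b, 'X_[b] \notin I -> qcoef b u = 0) -> u = 0.
Proof.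
move=> u0; rewrite -(quotmod_piK u); apply/quotmod_pi_eq0.
apply: mem_msupp_ideal => b; rewrite mcoeff_msupp; apply: contraNT => bI.
by rewrite -qcoef_pi // quotmod_piK u0.
Qed.

(** The monomial of degree [a] in the component of the subset [F] of the Koszul
    complex of the powers [x_j ^ t] is [x ^ (a + t 1_F)]. *)
Definition expo a t F (i : 'I_d) : int := a i + (ones t F i)%:Z.

Lemma onesE t F i : ones t F i = (if nth false F i then t else 0)%N.
Proof. by rewrite mnmE; case: nth; rewrite ?muln1 ?muln0. Qed.

Definition expo_ge0 a t F := [forall i, 0 <= expo a t F i].

Definition mono a t F : 'X_{1..d} := [multinom absz (expo a t F i) | i < d].

Definition alive a t F := expo_ge0 a t F && ~~ `[< 'X_[mono a t F] \in I >].

Definition component a t c F : k :=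
  if alive a t F then qcoef (mono a t F) (c F) else 0.

Lemma monoE a t F i : expo_ge0 a t F -> (mono a t F i)%:Z = expo a t F i.
Proof. by move=> /forallP/(_ i) h; rewrite mnmE gez0_abs. Qed.

Lemma mono_degree_inj a a' t F : expo_ge0 a t F -> expo_ge0 a' t F ->
  mono a t F = mono a' t F -> a = a'.
Proof.
move=> a0 a'0 aa'; apply/ffunP => i.
by have := monoE i a0; rewrite aa' monoE // => /addIr ->.
Qed.

Lemma nth_off F j i :
  nth false (set_nth false F j false) i =
  if i == j then false else nth false F i.
Proof. by rewrite nth_set_nth. Qed.

(** Multiplication by [x_j ^ t] maps the monomial of degree [a] for the subset
    without [j] to the one for the subset with [j], so in degree [a] it is the
    identity of [k] as long as both monomials are alive. *)
Lemma component_d a t c F : size F = d -> alive a t F ->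
  component a t (koszul_d (powers k d t) c) F =
  koszul_d (nseq d 1) (component a t c : seq bool -> k^o) F.
Proof.
move=> sF aF; rewrite {1}/component aF.
move: aF => /andP[eF /asboolPn/negP nF].
apply: (koszul_d_transport (L := qcoef (mono a t F)) (N := k^o)).
- by rewrite size_powers size_nseq.
- by rewrite size_powers.
- exact: qcoef0.
- exact: qcoefB.
move=> j Fj; have jd : (j < d)%N.
  by rewrite -sF ltnNge; apply/negP => /(nth_default false); rewrite Fj.
pose i := Ordinal jd; rewrite -[j]/(val i) nth_powers mpolyXn qcoefX //.
set F' := set_nth _ _ _ _; rewrite nth_nseq jd scale1r /component.
have Fi' (l : 'I_d) : nth false F' l = (l != i) && nth false F l.
  by rewrite nth_off -val_eqE /=; case: eqP.
have eF' : expo_ge0 a t F' = (0 <= a i).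
  apply/forallP/idP => [/(_ i)|ai l]; rewrite /expo onesE Fi'.
    by rewrite eqxx addr0.
  case: eqVneq => [->|_] /=; first by rewrite addr0.
  by move/forallP: eF => /(_ l); rewrite /expo onesE.
have le : (U_(i) *+ t <= mono a t F)%MM = (0 <= a i).
  have ie := monoE i eF; rewrite /expo onesE Fj in ie.
  apply/mnm_lepP/idP => [/(_ i)|ai l]; rewrite mulmnE mnm1E ?eqxx; first by lia.
  by case: eqVneq => [<-|//]; lia.
rewrite le /alive eF'; case: ifP => //= ai.
have -> : mono a t F' = (mono a t F - U_(i) *+ t)%MM.
  apply/mnmP => l; apply/eqP; rewrite -eqz_nat monoE ?eF' //.
  have := monoE l eF; rewrite mnmBE mulmnE mnm1E /expo !onesE Fi'.
  case: (eqVneq l i) => [->|li] /=; last by rewrite mul0n subn0 => ->.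
  by rewrite Fj; move: (a i) (mono a t F i) ai => x y; lia.
case: asboolP => //= /(mem_monomial_le (lem_subr _ _)).
by rewrite (negbTE nF).
Qed.

Lemma component_wt a t s c F : size F = d -> alive a (t + s) F ->
  component a (t + s) (fun G => koszul_wt (powers k d s) G *: c G) F =
  component a t c F.
Proof.
move=> sF aF; rewrite /component aF.
move: aF => /andP[eF /asboolPn/negP nF].
rewrite koszul_wt_powers // qcoefX //.
have eE l : expo a (t + s) F l = expo a t F l + (ones s F l)%:Z.
  by rewrite /expo !onesE; case: nth; lia.
have le : (ones s F <= mono a (t + s) F)%MM = expo_ge0 a t F.
  apply/mnm_lepP/forallP => h l; have := h l; have := monoE l eF.
    by rewrite eE; lia.
  by rewrite eE; lia.
rewrite le /alive; case: ifP => //= et.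
have -> : mono a t F = (mono a (t + s) F - ones s F)%MM.
  apply/mnmP => l; have := monoE l et; have := monoE l eF.
  by rewrite eE mnmBE; lia.
by case: asboolP => // /(mem_monomial_le (lem_subr _ _)); rewrite (negbTE nF).
Qed.

End Degrees.
Section Spanning.
Variables (k : fieldType) (T : Type).
Implicit Types (Z B : (T -> k^o) -> Prop).
Local Notation dim_ge := (@dim_ge k k idfun T k^o).

Definition linear_closed_pred B :=
  forall x f g, B f -> B g -> B (fun t => x * f t + g t).

Lemma dim_ge0 Z B : dim_ge Z B 0.
Proof. by exists (fun _ _ => 0); split=> [[]|a _ []]. Qed.

(** A vector outside the span, modulo [B], would enlarge the family. *)
Lemma independent_span Z B h (z : 'I_h -> T -> k^o) : linear_closed_pred B ->
  B (fun=> 0) -> (forall r, Z (z r)) -> independent idfun B z ->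
  ~ dim_ge Z B h.+1 -> forall g, Z g ->
  exists c : 'I_h -> k, B (fun t => g t - \sum_r c r * z r t).
Proof.
move=> Blin B0 Zz zB max g Zg; apply: contrapT => /forallNP ng; apply: max.
exists (fun r => if unlift ord_max r is Some r' then z r' else g).
split=> [r|a]; first by case: unliftP.
under eq_fun => x do rewrite big_ord_recr /= unlift_none.
have wE r : widen_ord (leqnSn h) r = lift ord_max r.
  by apply: val_inj; rewrite /= /bump leqNgt ltn_ord.
under eq_fun => x do under eq_bigr => r _ do rewrite wE liftK.
move=> Ba; have a0 : a ord_max = 0.
  apply: contrapT => /eqP a0.
  case: (ng (fun r => - (a ord_max)^-1 * a (lift ord_max r))).
  have := Blin (a ord_max)^-1 _ _ Ba B0; congr B; apply: funext => x.
  rewrite addr0 mulrDr -[_ *: g x]/(_ * _) mulKf //.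
  rewrite addrC mulr_sumr -sumrN; congr (_ + _); apply: eq_bigr => r _.
  by rewrite -[_ *: _]/(_ * _) !mulNr opprK mulrA.
have /zB za : B (fun x => \sum_r idfun (a (lift ord_max r)) *: z r x).
  by move: Ba; congr B; apply: funext => x; rewrite a0 scale0r addr0.
by move=> r; case: (unliftP ord_max r) => [r' ->|->]; [apply: za|].
Qed.

End Spanning.

Section Patterns.
Variables (k : fieldType) (d p : nat).
Implicit Types (P : {set d.-tuple bool}) (F : seq bool).
Local Notation dim_ge := (@dim_ge k k idfun (seq bool) k^o).

Definition in_pattern P F := [exists T in P, val T == F].

Lemma in_pattern_tuple P (T : d.-tuple bool) : in_pattern P T = (T \in P).
Proof.
apply/existsP/idP => [[T' /andP[TP /eqP/val_inj <-]] //|TP].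
by exists T; rewrite TP eqxx.
Qed.

(** The degree [p] part of the subquotient, carried by the subsets in [P], of
    the Koszul complex of the sequence [1, ..., 1]. *)
Definition pattern_cocycle P (c : seq bool -> k^o) : Prop :=
  (forall F, ~~ in_pattern P F -> c F = 0) /\
  (forall F, face d p.+1 F -> in_pattern P F -> koszul_d (nseq d 1) c F = 0).

Definition pattern_coboundary P (c : seq bool -> k^o) : Prop :=
  exists2 u : seq bool -> k^o, forall F, ~~ in_pattern P F -> u F = 0 &
    forall F, face d p F -> in_pattern P F -> c F = koszul_d (nseq d 1) u F.

Lemma pattern_coboundary_linear P : linear_closed_pred (pattern_coboundary P).
Proof.
move=> x f g [u u0 fu] [v v0 gv]; exists (fun F => x *: u F + v F) => F.
  by move=> FP; rewrite u0 // v0 // scaler0 addr0.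
by move=> Fp FP; rewrite koszul_dD koszul_dZ fu // gv.
Qed.

Lemma pattern_coboundary0 P : pattern_coboundary P (fun=> 0).
Proof. by exists (fun=> 0) => // F _ _; rewrite koszul_d0. Qed.

(** A cochain that vanishes at all subsets is a coboundary, and there are [2 ^ d]
    subsets, which bounds the dimension. *)
Lemma pattern_dim_exists P :
  exists h, dim_ge (pattern_cocycle P) (pattern_coboundary P) h /\
    ~ dim_ge (pattern_cocycle P) (pattern_coboundary P) h.+1.
Proof.
apply: contrapT => nh.
have all_ge l : dim_ge (pattern_cocycle P) (pattern_coboundary P) l.
  elim: l => [|l IHl]; first exact: dim_ge0.
  by apply: contrapT => nl; apply: nh; exists l.
have [c [_ cB]] := all_ge #|{: d.-tuple bool}|.+1.
have [a [r ar] aE] :=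
  left_kernel (fun r (s : 'I_#|{: d.-tuple bool}|) => c r (enum_val s))
    (ltnSn _).
rewrite cB ?eqxx // in ar; have := pattern_coboundary0 P.
move=> [u u0 uE]; exists u => // F Fp FP; rewrite -uE //.
case/existsP: FP => T /andP[_ /eqP <-].
by have := aE (enum_rank T); rewrite enum_rankK.
Qed.

Definition pattern_dim P : nat := projT1 (cid (pattern_dim_exists P)).

Lemma pattern_basis_exists P : exists z : 'I_(pattern_dim P) -> seq bool -> k^o,
  [/\ forall r, pattern_cocycle P (z r),
      independent idfun (pattern_coboundary P) z &
      forall g, pattern_cocycle P g -> exists c : 'I_(pattern_dim P) -> k,
        pattern_coboundary P (fun F => g F - \sum_r c r * z r F)].
Proof.
rewrite /pattern_dim; case: cid => h /= [[z [Zz zB]] hmax].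
exists z; split=> //; apply: independent_span => //.
- exact: pattern_coboundary_linear.
- exact: pattern_coboundary0.
Qed.

Definition pattern_basis P := sval (cid (pattern_basis_exists P)).

Lemma pattern_basisP P :
  [/\ forall r, pattern_cocycle P (@pattern_basis P r),
      independent idfun (pattern_coboundary P) (@pattern_basis P) &
      forall g, pattern_cocycle P g -> exists c : 'I_(pattern_dim P) -> k,
        pattern_coboundary P
          (fun F => g F - \sum_r c r * @pattern_basis P r F)].
Proof. exact: svalP (cid (pattern_basis_exists P)). Qed.

End Patterns.

Section MonomialKoszul.
Variables (k : fieldType) (d p : nat).
Local Notation R := {mpoly k[d]}.
Variable I : ideal R.
Hypothesis I_monomial : monomial_ideal I.
Local Notation M := (quotmod I).
Local Notation degree := {ffun 'I_d -> int}.
Implicit Types (a : degree) (F : seq bool) (T : d.-tuple bool).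
Local Notation component := (@component k d I).
Local Notation alive := (@alive k d I).

(** The subsets [T] such that [x ^ a] is a nonzero element of the localization
    of [R / I] at the variables of [T]. *)
Definition degree_pattern a : {set d.-tuple bool} :=
  [set T : d.-tuple bool | [forall j : 'I_d, nth false T j || (0 <= a j)] &&
     ~~ `[< exists2 m : 'X_{1..d}, 'X_[m] \in I &
              forall j : 'I_d, ~~ nth false T j -> (m j)%:Z <= a j >]].

(** For large [t] the exponents [a + t 1_T] are nonnegative on [T], and they
    exceed those of a given monomial of [I] there; what remains are the
    conditions on the coordinates outside [T]. *)
Lemma alive_pattern1 a T : exists t0, forall t, (t0 <= t)%N ->
  alive a t T = (T \in degree_pattern a).
Proof.
rewrite inE.
have [aT|/forallPn[j]] :=
  boolP [forall j : 'I_d, nth false T j || (0 <= a j)]; last first.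
  rewrite negb_or => /andP[jT aj]; exists 0%N => t _ /=; rewrite /alive.
  apply/negbTE; rewrite negb_and; apply/orP; left.
  rewrite /expo_ge0; apply/forallPn; exists j.
  by rewrite /expo onesE (negbTE jT) addr0.
case: asboolP => [[m mI mT]|nm] /=.
  exists (\max_j (m j + absz (a j)))%N => t tm; apply/negbTE; rewrite negb_and.
  have [e0|//] := boolP (expo_ge0 a t T); apply/orP; right; rewrite negbK.
  apply/asboolP; apply: mem_monomial_le mI; apply/mnm_lepP => j.
  rewrite -lez_nat monoE // /expo onesE; case: ifPn => Tj; last first.
    by rewrite addr0 mT.
  have := leq_trans (leq_bigmax (F := fun j => m j + absz (a j))%N j) tm.
  by move: (a j) (m j) => x y; lia.
exists (\max_j absz (a j))%N => t tm.
have e0 : expo_ge0 a t T.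
  apply/forallP => j; rewrite /expo onesE; move/forallP: aT => /(_ j).
  case: ifP => /= Tj; last by rewrite addr0.
  move=> _; have := leq_trans (leq_bigmax (F := fun j => absz (a j)) j) tm.
  by move: (a j) => x; lia.
rewrite /alive e0 /=; apply/asboolP => mI; apply: nm; exists (mono a t T) => //.
by move=> j Tj; rewrite monoE // /expo onesE (negbTE Tj) addr0.
Qed.

Lemma alive_pattern (s : seq degree) : exists t0, forall t, (t0 <= t)%N ->
  forall a F, a \in s -> size F = d ->
    alive a t F = in_pattern (degree_pattern a) F.
Proof.
have tex a : exists t0, forall t T, (t0 <= t)%N ->
    alive a t T = (T \in degree_pattern a).
  have [t0 t0P] := choice (alive_pattern1 a).
  exists (\max_T t0 T)%N => t T tT; apply: t0P.
  exact: leq_trans (leq_bigmax T) tT.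
have [t1 t1P] := choice tex.
exists (\max_(a <- s) t1 a)%N => t ts a F sa /eqP sF.
rewrite -[F]/(val (Tuple sF)) in_pattern_tuple; apply: t1P.
by apply: leq_trans ts; apply: leq_bigmax_seq.
Qed.

Lemma component_ext t (c c' : seq bool -> M) F : size F = d ->
  (forall a, alive a t F -> component a t c F = component a t c' F) ->
  c F = c' F.
Proof.
move=> sF cc'; apply/eqP; rewrite -subr_eq0; apply/eqP.
apply: (qcoef_eq0 I_monomial) => b bI.
pose a : degree := [ffun i => (b i)%:Z - (ones d t F i)%:Z].
have eE i : expo a t F i = (b i)%:Z by rewrite /expo ffunE subrK.
have mE : mono a t F = b by apply/mnmP => i; rewrite mnmE eE.
have aF : alive a t F.
  rewrite /alive mE; apply/andP; split; last by apply/asboolPn/negP.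
  by apply/forallP => i; rewrite eE.
have := cc' a aF; rewrite /component aF mE => E.
by rewrite qcoefB // E subrr.
Qed.

(** Reconstruction of a cochain from finitely many components. *)
Definition synthesis (s : seq degree) t (e : degree -> seq bool -> k) F : M :=
  \sum_(a <- s) if alive a t F
                then (e a F)%:MP *: quotmod_pi I 'X_[mono a t F] else 0.

Lemma component_synthesis s t e a F : uniq s -> alive a t F ->
  component a t (synthesis s t e) F = if a \in s then e a F else 0.
Proof.
move=> us aF; rewrite /component aF /synthesis.
case: (andP aF) => eF /asboolPn/negP nF.
have coefD : {morph qcoef (mono a t F) : u v / (u : M) + v >-> u + v}.
  move=> u v; rewrite -[v in LHS]opprK qcoefB // -[- v]sub0r qcoefB //.
  by rewrite qcoef0 // sub0r opprK.
rewrite (big_morph _ coefD (qcoef0 I_monomial _)) {coefD}.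
have termE a' : qcoef (mono a t F) (if alive a' t F
    then (e a' F)%:MP *: quotmod_pi I 'X_[mono a' t F] else 0) =
    if a' == a then e a F else 0.
  have [->|a'a] := eqVneq a' a.
    by rewrite aF qcoefC // qcoef_pi // mcoeffX eqxx mulr1.
  case: ifP => [/andP[eF' _]|_]; last exact: qcoef0.
  rewrite qcoefC // qcoef_pi // mcoeffX.
  case: eqP => [/mono_degree_inj E|]; last by rewrite mulr0.
  by rewrite E ?eqxx // in a'a.
under eq_bigr => a' _ do rewrite termE.
rewrite -big_mkcond /=; case: ifPn => [sa|sa]; last first.
  rewrite big_seq_cond big1 // => a' /andP[sa' /eqP E].
  by rewrite E (negbTE sa) in sa'.
rewrite (big_rem a) //= eqxx big_seq_cond big1 ?addr0 // => a' /andP[+ /eqP E].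
by rewrite E mem_rem_uniqF.
Qed.

Lemma component_sum a t l (x : 'I_l -> k) (c : 'I_l -> seq bool -> M) F :
  component a t (fun G => \sum_r (x r)%:MP *: c r G) F =
  \sum_r x r * component a t (c r) F.
Proof.
rewrite /component; case: ifP => _; last first.
  by rewrite big1 // => r _; rewrite mulr0.
by rewrite qcoef_sum //; apply: eq_bigr => r _; rewrite qcoefC.
Qed.

Definition degrees_of t (c : seq bool -> M) : seq degree :=
  flatten [seq [seq [ffun i => (b i)%:Z - (ones d t T i)%:Z]
                   | b : 'X_{1..d} <- msupp (quotmod_repr (c T) : R)]
               | T : d.-tuple bool <- enum {: d.-tuple bool}].

Lemma component_degrees a t c F : size F = d ->
  component a t c F != 0 -> a \in degrees_of t c.
Proof.
move=> /eqP sF; rewrite /component; case: ifP; rewrite ?eqxx //.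
move=> /andP[eF _]; rewrite /qcoef; case: asboolP; rewrite ?eqxx // => _.
rewrite -mcoeff_msupp => bF; apply/flattenP.
eexists; first by apply/mapP; exists (Tuple sF); rewrite ?mem_enum.
apply/mapP; exists (mono a t F) => //; apply/ffunP => i.
by rewrite ffunE monoE // /expo addrK.
Qed.

End MonomialKoszul.
Section MonomialDimension.
Variables (k : fieldType) (d p : nat).
Local Notation R := {mpoly k[d]}.
Variable I : ideal R.
Hypothesis I_monomial : monomial_ideal I.
Local Notation M := (quotmod I).
Local Notation degree := {ffun 'I_d -> int}.
Implicit Types (a : degree) (F : seq bool).
Local Notation component := (@component k d I).
Local Notation alive := (@alive k d I).
Local Notation pattern a := (degree_pattern I a).
Local Notation z P := (@pattern_basis k d p P).
Local Notation dim a := (@pattern_dim k d p (pattern a)).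

Lemma in_pattern_size (P : {set d.-tuple bool}) F :
  in_pattern P F -> size F = d.
Proof. by case/existsP => T /andP[_ /eqP <-]; rewrite size_tuple. Qed.

(** Pattern cochains vanish off the pattern, in particular at the sequences that
    are not characteristic sequences of subsets of the variables. *)
Definition cut_component t a (c : seq bool -> M) F : k^o :=
  if size F == d then component a t c F else 0.

Lemma koszul_d_cut t a (c : seq bool -> M) F : size F = d -> alive a t F ->
  component a t (koszul_d (powers k d t) c) F =
  koszul_d (nseq d 1) (cut_component t a c) F.
Proof.
move=> sF aF; rewrite component_d //; apply: (@eq_koszul_d k k^o) => G sG _.
by rewrite /cut_component sG sF eqxx.
Qed.

Lemma cut_component_cocycle t a c :
  (forall F, size F = d -> alive a t F = in_pattern (pattern a) F) ->
  koszul_cocycle t p c ->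
  pattern_cocycle p (pattern a) (cut_component t a c).
Proof.
move=> aP dc; split=> [F nF|F Fp FP].
  rewrite /cut_component; case: eqP => // sF; rewrite /component aP //.
  by rewrite (negbTE nF).
have sF := in_pattern_size FP; rewrite -koszul_d_cut ?aP // /component aP // FP.
by rewrite dc // qcoef0.
Qed.

(** Finitely many cochains involve finitely many degrees. If there were more of
    them than the sum of the dimensions in these degrees, some combination would
    be a coboundary in each degree for a large exponent, and the primitives in
    the various degrees would add up to a primitive of the combination. *)
Lemma koszul_dim_le t l :
  dim_ge (@mpolyC d k) (koszul_cocycle t p : (seq bool -> M) -> Prop)
    (koszul_coboundary t p) l ->
  exists s : seq degree, uniq s /\ (l <= \sum_(a <- s) dim a)%N.
Proof.
move=> [c [Zc cB]].
pose s := undup (flatten [seq degrees_of t (c r) | r <- enum 'I_l]).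
have us : uniq s by apply: undup_uniq.
have sP r a F : size F = d -> component a t (c r) F != 0 -> a \in s.
  move=> sF /(component_degrees sF) ca; rewrite mem_undup; apply/flattenP.
  by exists (degrees_of t (c r)) => //; apply/mapP; exists r; rewrite ?mem_enum.
exists s; split=> //; rewrite leqNgt; apply/negP => ltl.
have [t0 t0P] := alive_pattern I s.
(* The cocycles are pushed to an exponent where the degrees in [s] have reached
   their patterns. *)
pose c' r F : M := koszul_wt (powers k d t0) F *: c r F.
pose t' := (t + t0)%N.
have aP a : a \in s -> forall F, size F = d ->
    alive a t' F = in_pattern (pattern a) F.
  by move=> sa F sF; rewrite t0P // leq_addl.
have Zc' r : koszul_cocycle t' p (c' r).
  by move=> F Fp; rewrite koszul_d_powers Zc // scaler0.
have zP := @pattern_basisP k d p.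
pose g a r := cut_component t' a (c' r).
have rex ar : exists x : nat -> k, ar.1 \in s ->
    pattern_coboundary p (pattern ar.1)
      (fun F => g ar.1 ar.2 F - \sum_(j < dim ar.1) x j * z (pattern ar.1) j F).
  have [sa|//] := EM (ar.1 \in s); last by exists (fun=> 0).
  have [_ _ span] := zP (pattern ar.1).
  have [x xP] := span _ (cut_component_cocycle (aP _ sa) (Zc' ar.2)).
  exists (fun j => if insub j is Some j' then x j' else 0) => _.
  move: xP; congr pattern_coboundary; apply: funext => F; congr (_ - _).
  by apply: eq_bigr => j _; rewrite valK.
have [x xP] := choice rex.
pose L := [seq (a, j) | a <- s, j <- iota 0 (dim a)].
have sL : size L = (\sum_(a <- s) dim a)%N.
  rewrite size_allpairs_dep sumnE big_map.
  by apply: eq_bigr => a _; rewrite size_iota.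
(* The matrix of coordinates of the cocycles in the bases of all degrees. *)
pose b (r : 'I_l) (q : 'I_(size L)) : k :=
  let: (a, j) := tnth (in_tuple L) q in
  x (a, r) j.
have [|y [r0 yr0] yb] := left_kernel b; first by rewrite sL.
have yx a j : a \in s -> (j < dim a)%N -> \sum_r y r * x (a, r) j = 0.
  move=> sa ja; have aL : (a, j) \in L.
    by apply/allpairsPdep; exists a, j; rewrite mem_iota.
  have /tnthP[q qE] : (a, j) \in in_tuple L by [].
  by rewrite -[RHS](yb q); apply: eq_bigr => r _; rewrite /b -qE.
have yB a : a \in s ->
    pattern_coboundary p (pattern a) (fun F => \sum_r y r * g a r F).
  move=> sa.
  have lin l' (v : 'I_l' -> k) (f : 'I_l' -> seq bool -> k^o) :
      (forall r, pattern_coboundary p (pattern a) (f r)) ->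
      pattern_coboundary p (pattern a) (fun F => \sum_r v r * f r F).
    elim: l' v f => [|l' IH] v f fB.
      have := @pattern_coboundary0 k d p (pattern a); congr pattern_coboundary.
      by apply: funext => F; rewrite big_ord0.
    have := pattern_coboundary_linear (v ord0) (fB ord0)
      (IH (fun r => v (lift ord0 r)) _ (fun r => fB (lift ord0 r))).
    by congr pattern_coboundary; apply: funext => F; rewrite big_ord_recl.
  have := lin _ y _ (fun r => xP (a, r) sa).
  congr pattern_coboundary; apply: funext => F /=.
  under eq_bigr => r _ do rewrite mulrBr mulr_sumr.
  rewrite sumrB exchange_big [X in _ - X]big1 ?subr0 // => j _.
  under eq_bigr => r _ do rewrite mulrA.
  by rewrite -mulr_suml yx // mul0r.
have eex a : exists e : seq bool -> k^o, a \in s ->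
    (forall F, ~~ in_pattern (pattern a) F -> e F = 0) /\
    forall F, face d p F -> in_pattern (pattern a) F ->
      \sum_r y r * g a r F = koszul_d (nseq d 1) e F.
  have [/yB[e e0 eE]|//] := EM (a \in s); first by exists e.
  by exists (fun=> 0).
have [e eP] := choice eex.
case/eqP: yr0; apply: (cB y).
exists t0, (synthesis I s t' e) => F Fp; have [sF _] := Fp.
apply: (@component_ext _ _ _ I_monomial t'
  (fun G => koszul_wt (powers k d t0) G *: (\sum_r (y r)%:MP *: c r G))
  (koszul_d (powers k d t') (synthesis I s t' e))) => // a aF.
rewrite koszul_d_cut // component_wt // component_sum //.
have uE G : size G = d ->
    cut_component t' a (synthesis I s t' e) G = if a \in s then e a G else 0.
  move=> sG; rewrite /cut_component sG eqxx.
  have [aG|aG] := boolP (alive a t' G).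
    exact: component_synthesis.
  rewrite /component (negbTE aG); case: ifP => // sa; have [e0 _] := eP a sa.
  by rewrite e0 // -aP.
have [sa|sa] := boolP (a \in s).
  have [_ eE] := eP a sa.
  rewrite (@eq_koszul_d _ _ _ _ (e a)) => [|G sG _]; last first.
    by rewrite uE ?sa // sG.
  rewrite -eE // -?aP //; apply: eq_bigr => r _.
  by rewrite /g /cut_component sF eqxx component_wt.
rewrite (@eq_koszul_d _ _ _ _ (fun=> 0)) => [|G sG _]; last first.
  by rewrite uE ?(negbTE sa) // sG.
rewrite koszul_d0 big1 // => r _.
have [->|ca] := eqVneq (component a t (c r) F) 0.
  by rewrite mulr0.
by rewrite (sP _ _ _ sF ca) in sa.
Qed.

(** Bases in the finitely many degrees of [s] are realized by cochains for one
    large exponent. A primitive of a combination at a larger exponent has a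
    component in each degree, where the pattern has not changed. *)
Lemma koszul_dim_ge l (s : seq degree) : uniq s ->
  (l <= \sum_(a <- s) dim a)%N ->
  exists t, dim_ge (@mpolyC d k) (koszul_cocycle t p : (seq bool -> M) -> Prop)
    (koszul_coboundary t p) l.
Proof.
move=> us ls; have [t tP] := alive_pattern I s.
have zP := @pattern_basisP k d p.
pose zz a j : seq bool -> k^o :=
  if insub j is Some j' then z (pattern a) j' else fun=> 0.
pose L := [seq (a, j) | a <- s, j <- iota 0 (dim a)].
have sL : size L = (\sum_(a <- s) dim a)%N.
  rewrite size_allpairs_dep sumnE big_map.
  by apply: eq_bigr => a _; rewrite size_iota.
have uL : uniq L.
  apply: allpairs_uniq_dep => // [a _|[a j] [a' j'] _ _ [-> ->] //].
  exact: iota_uniq.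
pose A (r : 'I_l) := (nth ([ffun=> 0], 0%N) L r).1.
pose J (r : 'I_l) := (nth ([ffun=> 0], 0%N) L r).2.
have AJ r : A r \in s /\ (J r < dim (A r))%N.
  have : (A r, J r) \in L.
    by rewrite /A /J -surjective_pairing mem_nth // sL (leq_trans (ltn_ord r)).
  by move=> /allpairsPdep[a [j [sa]]]; rewrite mem_iota => jd [-> ->].
have aP t' a F : (t <= t')%N -> a \in s -> size F = d ->
    alive a t' F = in_pattern (pattern a) F.
  by move=> tt' sa sF; rewrite tP.
pose c r : seq bool -> M := synthesis I [:: A r] t (fun a => zz a (J r)).
have zz0 a j F : ~~ in_pattern (pattern a) F -> zz a j F = 0.
  move=> nF; rewrite /zz; case: insub => // j'.
  by have [/(_ j')[z0 _] _ _] := zP (pattern a); rewrite z0.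
have cE r a F : size F = d -> alive a t F ->
    component a t (c r) F = if a == A r then zz a (J r) F else 0.
  by move=> sF aF; rewrite component_synthesis // inE.
exists t, c; split=> [r F Fp|y [s' [u uE]] r0].
  have [sF _] := Fp; have [sA jA] := AJ r.
  apply: (@component_ext _ _ _ I_monomial t (koszul_d (powers k d t) (c r))
    (fun=> 0)) => // a aF.
  rewrite koszul_d_cut //.
  have -> : component a t (fun=> 0) F = 0 by rewrite /component aF qcoef0.
  have cutE G : size G = d ->
      cut_component t a (c r) G = if a == A r then zz a (J r) G else 0.
    move=> sG; rewrite /cut_component sG eqxx.
    have [aG|aG] := boolP (alive a t G); first exact: cE.
    rewrite /component (negbTE aG); case: eqP => // aA.
    by rewrite zz0 // -(aP t) // aA.
  rewrite (@eq_koszul_d _ _ _ _ (if a == A r then zz a (J r) else fun=> 0)).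
    case: eqP => [aA|_]; last exact: (@koszul_d0 k k^o).
    rewrite aA /zz (insubT (fun j => j < dim (A r))%N jA).
    have [/(_ (Sub (J r) jA))[_ dz] _ _] := zP (pattern (A r)).
    by rewrite dz // -(aP t) // -aA.
  by move=> G sG _; rewrite cutE ?sG //; case: eqP.
pose a := A r0; have [sa ja] := AJ r0; rewrite -/a in sa ja.
pose y' (j : 'I_(dim a)) := \sum_(r | (A r, J r) == (a, val j)) y r.
have [_ zB _] := zP (pattern a).
have sumE F : \sum_j y' j * z (pattern a) j F =
    \sum_r y r * (if a == A r then zz a (J r) F else 0).
  transitivity (\sum_r
      \sum_(j | (A r, J r) == (a, val j)) y r * z (pattern a) j F).
    rewrite [RHS](exchange_big_dep xpredT) //=; apply: eq_bigr => j _.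
    by rewrite /y' mulr_suml.
  apply: eq_bigr => r _; have [_ Jr] := AJ r.
  case: (eqVneq a (A r)) => [aA|aA]; last first.
    rewrite mulr0 big1 // => j; rewrite xpair_eqE => /andP[/eqP E _].
    by rewrite E eqxx in aA.
  rewrite /zz; rewrite -aA in Jr; rewrite (insubT (fun j => j < dim a)%N Jr).
  rewrite (big_pred1 (Sub (J r) Jr)) // => j.
  by rewrite -aA xpair_eqE eqxx /= -val_eqE eq_sym.
have y'0 : forall j, y' j = 0.
  apply: zB; exists (cut_component (t + s') a u) => [F nF|F Fp FP].
    rewrite /cut_component; case: eqP => // sF.
    by rewrite /component aP ?leq_addr // (negbTE nF).
  have sF := in_pattern_size FP.
  have aF : alive a (t + s') F by rewrite aP ?leq_addr.
  rewrite [LHS]sumE -koszul_d_cut // /component aF -uE //.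
  have := component_wt I_monomial (fun G => \sum_r (y r)%:MP *: c r G) sF aF.
  rewrite {1}/component aF => ->; rewrite component_sum //.
  by apply: eq_bigr => r _; rewrite cE // aP.
have := y'0 (Sub (J r0) ja); rewrite /y' (big_pred1 r0) // => r /=.
rewrite /A /J -!surjective_pairing.
by rewrite nth_uniq // sL (leq_trans (ltn_ord _)).
Qed.

End MonomialDimension.
(** * The semigroups of a noetherian graded family *)

Section Families.
Variables (k : fieldType) (d : nat).
Local Notation R := {mpoly k[d]}.
Local Notation degree := {ffun 'I_d -> int}.
Local Notation V := (degree * int)%type.
Implicit Types (m b : 'X_{1..d}) (n : nat).

Definition embed m n : V := ([ffun i => (m i)%:Z], n%:Z).

Definition unit_vec (j : 'I_d) : V := ([ffun i => (j == i)%:Z], 0).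

Definition unit_vecs : seq V := [seq unit_vec j | j <- enum 'I_d].

Lemma embedD m m' n n' : embed (m + m')%MM (n + n') = embed m n + embed m' n'.
Proof.
by congr pair => //; apply/ffunP => i; rewrite !ffunE mnmDE PoszD.
Qed.

Lemma unit_vecs_span (s : seq V) (a : degree) :
  {subset unit_vecs <= s} -> (forall i, 0 <= a i) -> nat_span s (a, 0).
Proof.
move=> us a0.
have span1 j c : nat_span s ([ffun i => (j == i)%:Z *+ c], 0).
  elim: c => [|c IHc].
    have -> : ([ffun i => (j == i)%:Z *+ 0], 0) = 0 :> V.
      by congr pair; apply/ffunP => i; rewrite !ffunE.
    exact: nat_span0.
  have -> : ([ffun i => (j == i)%:Z *+ c.+1], 0) =
      unit_vec j + ([ffun i => (j == i)%:Z *+ c], 0) :> V.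
    by congr pair; apply/ffunP => i; rewrite !ffunE mulrS.
  apply: nat_spanD => //; apply: nat_span_mem; apply: us.
  by apply/mapP; exists j; rewrite ?mem_enum.
have -> : a = [ffun i => if i \in enum 'I_d then a i else 0].
  by apply/ffunP => i; rewrite ffunE mem_enum.
elim: (enum 'I_d) (enum_uniq 'I_d) => [_|j l IHl /andP[jl ul]].
  have -> : ([ffun i => if i \in [::] then a i else 0], 0) = 0 :> V.
    by congr pair; apply/ffunP => i; rewrite !ffunE.
  exact: nat_span0.
have -> : ([ffun i => if i \in j :: l then a i else 0], 0) =
    ([ffun i => (j == i)%:Z *+ absz (a j)], 0) +
    ([ffun i => if i \in l then a i else 0], 0) :> V.
  congr pair; apply/ffunP => i; rewrite !ffunE inE eq_sym.
  case: (eqVneq j i) => [<-|_] /=; last by rewrite mul0rn add0r.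
  by rewrite (negbTE jl) addr0 -mulr_natr mul1r natz gez0_abs.
by apply: nat_spanD => //; apply: IHl.
Qed.

Variable I : nat -> ideal R.
Hypothesis I_monomial : forall n, monomial_ideal (I n).
Hypothesis I_graded : graded_family I.

Lemma family0 : 'X_[0%MM] \in I 0%N.
Proof. by have [I0 _] := I_graded; apply: I0. Qed.

Lemma familyD m m' n n' :
  'X_[m] \in I n -> 'X_[m'] \in I n' -> 'X_[m + m'] \in I (n + n')%N.
Proof.
move=> mI m'I; have [_ IM] := I_graded; apply: IM.
apply/asboolP; exists [:: (1, 'X_[m + m'])]; rewrite big_seq1 mul1r.
split=> // q; rewrite inE => /eqP -> /=.
by exists 'X_[m], 'X_[m']; rewrite mpolyXD.
Qed.

(** Take the exponents of the monomials in algebra generators of the Rees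
    algebra, and the variables: the polynomials with all exponents in the
    semigroup that they generate form a subalgebra, which therefore contains the
    Rees algebra. *)
Lemma rees_semigroup : noetherian_family I ->
  exists G : seq ('X_{1..d} * nat), (forall g, g \in G -> 'X_[g.1] \in I g.2) /\
    forall m n, 'X_[m] \in I n ->
      nat_span ([seq embed g.1 g.2 | g <- G] ++ unit_vecs) (embed m n).
Proof.
move=> [r [g [gI gen]]].
pose G : seq ('X_{1..d} * nat) := flatten [seq flatten
  [seq [seq (b, n) | b : 'X_{1..d} <- msupp (g j)`_n]
     | n <- iota 0 (size (g j))]
  | j <- enum 'I_r].
have GP (j : 'I_r) n b : b \in msupp (g j)`_n -> (b, n) \in G.
  move=> bg; apply/flattenP; eexists.
    by apply/mapP; exists j; rewrite ?mem_enum.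
  apply/flattenP; exists [seq (b, n) | b : 'X_{1..d} <- msupp (g j)`_n];
    last by apply/mapP; exists b.
  apply/mapP; exists n => //; rewrite mem_iota /= add0n ltnNge.
  by apply: contraTN bg => jn; rewrite nth_default // msupp0.
pose S := nat_span ([seq embed x.1 x.2 | x <- G] ++ unit_vecs).
exists G; split=> [x /flattenP[l /mapP[j _ ->]]|m n mI].
  move=> /flattenP[l' /mapP[n _ ->]] /mapP[b bg ->] /=.
  exact: (mem_monomial_ideal _ (I_monomial n)).1 (gI j n) b bg.
pose good (p : {poly R}) := forall n b, b \in msupp p`_n -> S (embed b n).
have good0 : good 0 by move=> n' b; rewrite coef0 msupp0.
have goodD p q : good p -> good q -> good (p + q).
  move=> gp gq n' b; rewrite coefD => /msuppD_le.
  by rewrite mem_cat => /orP[/gp|/gq].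
have goodM p q : good p -> good q -> good (p * q).
  move=> gp gq n' b; rewrite coefM => /msupp_sum_le /flattenP[l /mapP[j _ ->]].
  move=> /msuppM_le /allpairsP[[b1 b2] [/gp b1p /gq b2q ->]].
  by rewrite -(subnKC (leq_ord j)) embedD; apply: nat_spanD.
have goodC (f : R) : good f%:P.
  move=> n' b; rewrite coefC; case: eqP => [->|_]; last by rewrite msupp0.
  move=> _; apply: unit_vecs_span => [v vu|i]; first by rewrite mem_cat vu orbT.
  by rewrite ffunE.
have goodg j : good (g j).
  move=> n' b /GP bG; apply: nat_span_mem; rewrite mem_cat; apply/orP; left.
  by apply/mapP; exists (b, n').
have [|q qE] := gen ('X_[m] *: 'X^n).
  move=> n'; rewrite coefZ coefXn; case: eqP => [->|_]; first by rewrite mulr1.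
  by rewrite mulr0; apply: rpred0.
suff gp : good ('X_[m] *: 'X^n).
  by apply: gp; rewrite coefZ coefXn eqxx mulr1 msuppX inE.
rewrite qE; apply: (big_ind good good0 goodD) => u _.
apply: (goodM _ _ (goodC _)).
apply: (big_ind good (goodC 1) goodM) => j _.
elim: (u j) => [|e IHe]; first by rewrite expr0; apply: (goodC 1).
by rewrite exprS; apply: (goodM _ _ (goodg j)).
Qed.

Variable G : seq ('X_{1..d} * nat).
Hypothesis GI : forall g, g \in G -> 'X_[g.1] \in I g.2.
Hypothesis IG : forall m n, 'X_[m] \in I n ->
  nat_span ([seq embed g.1 g.2 | g <- G] ++ unit_vecs) (embed m n).

Definition cut T (v : V) : V :=
  ([ffun i => if nth false T (i : 'I_d) then 0 else v.1 i], v.2).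

(** The monomials, without negative exponents, that lie in the localizations of
    the [I n] at the variables of [T]. As these variables become invertible, the
    coordinates in [T] of the generators are cleared. *)
Definition local_semigroup T : V -> Prop :=
  nat_span ([seq cut T (embed g.1 g.2) | g <- G] ++ unit_vecs).

Lemma local_semigroupP T (a : degree) n : (forall i, 0 <= a i) ->
  local_semigroup T (a, n%:Z) <->
  exists2 m, 'X_[m] \in I n &
    forall j : 'I_d, ~~ nth false T j -> (m j)%:Z <= a j.
Proof.
move=> a0; split.
  suff : forall v, local_semigroup T v -> (forall i, 0 <= v.1 i) /\
      exists m n', [/\ v.2 = n'%:Z, 'X_[m] \in I n' &
        forall j : 'I_d, ~~ nth false T j -> (m j)%:Z <= v.1 j].
    by move=> /[apply] -[_ [m [n' [/= [<-] mI ma]]]]; exists m.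
  apply: nat_span_ind => [|v v' [v0 [m [n1 [vn mI mv]]]]
    [v'0 [m' [n2 [vn' mI' mv']]]]|v].
  - split=> [i|]; first by rewrite ffunE.
    exists 0%MM, 0%N; split=> // [|j _]; first exact: family0.
    by rewrite mnm0E ffunE.
  - split=> [i|]; first by rewrite ffunE addr_ge0.
    exists (m + m')%MM, (n1 + n2)%N; split=> [||j jT].
    + by rewrite /= vn vn'.
    + exact: familyD.
    by rewrite mnmDE PoszD ffunE lerD ?mv ?mv'.
  rewrite mem_cat => /orP[/mapP[g gG ->]|/mapP[j _ ->]].
    split=> [i|]; first by rewrite /= !ffunE; case: ifP.
    exists g.1, g.2; split=> // [|j jT]; first exact: GI.
    by rewrite /= !ffunE (negbTE jT).
  split=> [i|]; first by rewrite /= ffunE.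
  exists 0%MM, 0%N; split=> // [|i _]; first exact: family0.
  by rewrite mnm0E /= ffunE.
move=> [m /IG mS ma].
have -> : (a, n%:Z) = cut T (embed m n) + (a - (cut T (embed m n)).1, 0) :> V.
  by congr pair; [rewrite [RHS]addrC subrK | rewrite addr0].
apply: nat_spanD; last first.
  apply: unit_vecs_span => [v vu|i]; first by rewrite mem_cat vu orbT.
  rewrite !ffunE subr_ge0; by case: ifPn => // /ma.
move: mS; move: (embed m n); apply: nat_span_ind => [|v v' Sv Sv'|v].
- have -> : cut T 0 = 0 by congr pair; apply/ffunP => i; rewrite !ffunE if_same.
  exact: nat_span0.
- have -> : cut T (v + v') = cut T v + cut T v'.
    by congr pair; apply/ffunP => i; rewrite !ffunE; case: ifP.
  exact: nat_spanD.
rewrite mem_cat => /orP[/mapP[g gG ->]|/mapP[j _ ->]].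
  apply: nat_span_mem; rewrite mem_cat; apply/orP; left.
  by apply/mapP; exists g.
apply: unit_vecs_span => [v' vu|i]; first by rewrite mem_cat vu orbT.
by rewrite !ffunE; case: ifP.
Qed.

Definition slope : nat := \max_(g <- G) mdeg g.1.

(** A product of height [n] has at most [n] factors among the generators of
    positive height; the other factors can be dropped, as [I 0] is the unit
    ideal. *)
Lemma bounded_witness m n : 'X_[m] \in I n -> exists2 m',
  'X_[m'] \in I n & forall j, (m' j <= minn (m j) (slope * n))%N.
Proof.
move=> /IG mS.
suff : forall v, nat_span ([seq embed g.1 g.2 | g <- G] ++ unit_vecs) v ->
    (forall i, 0 <= v.1 i) /\ exists m' n', [/\ v.2 = n'%:Z, 'X_[m'] \in I n' &
      forall j, (m' j)%:Z <= v.1 j /\ (m' j <= slope * n')%N].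
  move=> /(_ _ mS)[_ [m' [n' [[<-] mI mm]]]]; exists m' => // j.
  by have [] := mm j; rewrite /= ffunE lez_nat leq_min => -> ->.
apply: nat_span_ind => [|v v' [v0 [m1 [n1 [vn mI mv]]]]
  [v'0 [m2 [n2 [vn' mI' mv']]]]|v].
- split=> [i|]; first by rewrite ffunE.
  exists 0%MM, 0%N; split=> // [|j]; first exact: family0.
  by rewrite mnm0E ffunE.
- split=> [i|]; first by rewrite ffunE addr_ge0.
  exists (m1 + m2)%MM, (n1 + n2)%N; split=> [||j].
  + by rewrite /= vn vn'.
  + exact: familyD.
  have [? ?] := mv j; have [? ?] := mv' j.
  by rewrite mnmDE PoszD ffunE lerD // mulnDr leq_add.
rewrite mem_cat => /orP[/mapP[[m1 n1] gG ->]|/mapP[j _ ->]] /=; last first.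
  split=> [i|]; first by rewrite ffunE.
  exists 0%MM, 0%N; split=> // [|i]; first exact: family0.
  by rewrite mnm0E ffunE.
split=> [i|]; first by rewrite ffunE.
(* A generator of height zero is replaced by the unit of [I 0]. *)
case: n1 gG => [|n1] gG.
  exists 0%MM, 0%N; split=> // [|i]; first exact: family0.
  by rewrite mnm0E ffunE.
exists m1, n1.+1; split=> // [|i]; first exact: GI gG.
rewrite ffunE lexx; split=> //.
have m1s : (mdeg m1 <= slope)%N by apply: (leq_bigmax_seq _ gG).
have : (m1 i <= mdeg m1)%N by rewrite mdegE (bigD1 i) //= leq_addr.
by nia.
Qed.

Lemma degree_pattern_eq n (a a' : degree) (T : d.-tuple bool) :
  (forall j, a' j = a j \/ ((slope * n)%:Z <= a j /\ (slope * n)%:Z <= a' j) \/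
     (a j < 0 /\ a' j < 0)) ->
  T \in degree_pattern (I n) a -> T \in degree_pattern (I n) a'.
Proof.
move=> aa'; rewrite !inE => /andP[/forallP a0 /asboolPn nm].
apply/andP; split.
  apply/forallP => j; have /orP[-> //|aj] := a0 j; apply/orP; right.
  by have [->|[[_]|[]]] := aa' j; [ | lia | lia].
apply/asboolPn => -[m /bounded_witness[m' m'I m'm] ma']; apply: nm.
exists m' => // j jT; have := m'm j; rewrite leq_min => /andP[h1 h2].
have /orP[jT'|aj] := a0 j; first by rewrite jT' in jT.
have := ma' j jT; have [->|[[h3 h4]|[h3 h4]]] := aa' j; lia.
Qed.

(** * The length as a sum over a box *)

Variable p : nat.

Definition degree_dim n (a : degree) : nat :=
  pattern_dim k p (degree_pattern (I n) a).

(** If a coordinate of [a] is negative or large, it can be moved to infinity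
    without changing the pattern; so a nonzero contribution in such a degree is
    repeated infinitely often. *)
Lemma degree_dim_box n l (a : degree) :
  (forall s : seq degree, uniq s -> (\sum_(b <- s) degree_dim n b <= l)%N) ->
  degree_dim n a != 0%N -> forall j, 0 <= a j <= (slope * n)%:Z.
Proof.
move=> bound a0 j; apply: contraT => aj.
have [u uP] : exists u : nat -> int, injective u /\ forall c,
    ((slope * n)%:Z <= a j /\ (slope * n)%:Z <= u c) \/ (a j < 0 /\ u c < 0).
  move: aj; move: (a j) => x; rewrite negb_and => /orP[xn|xn].
    exists (fun c => - c.+1%:Z); split=> [c c' /oppr_inj[] //|c]; right; lia.
  exists (fun c => (slope * n + c)%N%:Z).
  by split=> [c c' [/addnI] //|c]; left; lia.
have [uinj uj] := uP.
pose b c : degree := [ffun i => if i == j then u c else a i].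
have binj : injective b.
  by move=> c c' /ffunP/(_ j); rewrite !ffunE eqxx => /uinj.
have ub : uniq [seq b c | c <- iota 0 l.+1] by rewrite map_inj_uniq ?iota_uniq.
have bE c : degree_dim n (b c) = degree_dim n a.
  congr pattern_dim; apply/setP => T.
  apply/idP/idP; apply: degree_pattern_eq => i; rewrite ffunE.
    case: eqP => [->|_]; last by left.
    by right; have [[]|[]] := uj c; [left|right].
  case: eqP => [->|_]; last by left.
  by right; have [[]|[]] := uj c; [left|right].
have := bound _ ub; rewrite big_map.
rewrite (eq_bigr (fun=> degree_dim n a)) => [|c _]; last exact: bE.
rewrite big_const_seq count_predT size_iota iter_addn_0.
by rewrite -lt0n in a0; nia.
Qed.

Definition box n : seq V :=
  [seq ([ffun i => (f i : nat)%:Z], n%:Z)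
     | f : {ffun 'I_d -> 'I_(slope * n).+1}].

(** The cone over the boxes, as a semigroup. *)
Definition in_box (v : V) : Prop :=
  0 <= v.2 /\ forall j, 0 <= v.1 j <= slope%:Z * v.2.

Lemma box_uniq n : uniq (box n).
Proof.
rewrite map_inj_uniq ?enum_uniq // => f f' [] /ffunP ff'; apply/ffunP => i.
by have := ff' i; rewrite !ffunE => -[] /val_inj.
Qed.

Lemma mem_box n v : v \in box n <-> in_box v /\ v.2 = n%:Z.
Proof.
split=> [/mapP[f _ ->] /=|[[_ vb] vn]].
  split=> //; split=> // j.
  by rewrite /= ffunE -PoszM !lez_nat /= -ltnS ltn_ord.
have vP j : (absz (v.1 j) < (slope * n).+1)%N.
  by have := vb j; rewrite vn -PoszM; move: (v.1 j) => x; lia.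
apply/mapP; exists [ffun j => Ordinal (vP j)]; first by rewrite mem_enum.
case: v vb vn {vP} (vP) => a x /= vb -> vP; congr pair; apply/ffunP => j.
by rewrite !ffunE /= gez0_abs //; have /andP[] := vb j.
Qed.

Lemma size_box n : size (box n) = ((slope * n).+1 ^ d)%N.
Proof. by rewrite size_map -cardE card_ffun !card_ord. Qed.

(** A point of height [n] is a sum of [n] points of height one: split off
    [min (slope, a_j)] in each coordinate. *)
Lemma box_fin_gen : fin_gen in_box.
Proof.
exists [seq ([ffun i => (f i : nat)%:Z], 1) | f : {ffun 'I_d -> 'I_slope.+1}].
move=> v; split; last first.
  move: v; apply: nat_span_ind => [|v v' [v0 vb] [v0' vb']|v /mapP[f _ ->]].
  - by split=> // j; rewrite ffunE mulr0.
  - split=> [|j]; first by rewrite addr_ge0.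
    have /andP[? ?] := vb j; have /andP[? ?] := vb' j.
    by rewrite ffunE mulrDr addr_ge0 ?lerD.
  by split=> // j; rewrite /= ffunE mulr1 !lez_nat /= -ltnS ltn_ord.
case: v => a x [/= x0 vb]; rewrite -(gez0_abs x0) in vb *.
move: (absz x) vb => {x x0} n; elim: n a => [|n IHn] a vb.
  have -> : (a, 0%N%:Z) = 0 :> V.
    congr pair; apply/ffunP => j; have := vb j; rewrite ffunE mulr0.
    by move: (a j) => y; lia.
  exact: nat_span0.
have fP j : (minn slope (absz (a j)) < slope.+1)%N by rewrite ltnS geq_minl.
pose f := [ffun j => Ordinal (fP j)].
pose a' : degree := [ffun j => (f j : nat)%:Z].
have -> : (a, n.+1%:Z) = (a', 1) + (a - a', n%:Z) :> V.
  by congr pair; rewrite [RHS]addrC subrK.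
apply: nat_spanD.
  by apply: nat_span_mem; apply/mapP; exists f; rewrite ?mem_enum.
apply: IHn => j; rewrite !ffunE /=; have := vb j.
by move: (a j) => y; nia.
Qed.

Definition height : {additive V -> int} := snd.

Lemma box_pos_graded : pos_graded height in_box.
Proof.
move=> [a x] [/= x0 vb] /eqP v0; rewrite lt_neqAle x0 andbT eq_sym.
apply/eqP => xE; apply: v0; rewrite xE in vb *; congr pair; apply/ffunP => j.
by have := vb j; rewrite mulr0 ffunE; move: (a j) => y; lia.
Qed.

Lemma degree_pattern_semigroup v n (T : d.-tuple bool) : v \in box n ->
  (T \in degree_pattern (I n) v.1) = ~~ `[< local_semigroup T v >].
Proof.
move=> /mem_box[]; case: v => a x [/= _ vb] ->; have a0 i : 0 <= a i.
  by have /andP[] := vb i.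
rewrite inE; have -> /= : [forall j : 'I_d, nth false T j || (0 <= a j)].
  by apply/forallP => j; rewrite a0 orbT.
by congr negb; apply/asboolP/asboolP => /(local_semigroupP T n a0).
Qed.

Definition box_dim n : rat := (\sum_(v <- box n) degree_dim n v.1)%:R.

Lemma box_dim_rat_gf : rat_gf box_dim.
Proof.
pose Ts := enum {: d.-tuple bool}.
pose g (bs : seq bool) : rat := (pattern_dim k p
  [set T : d.-tuple bool | ~~ nth false bs (index T Ts)])%:R.
have fg (T : d.-tuple bool) : fin_gen (local_semigroup T).
  by exists ([seq cut T (embed x.1 x.2) | x <- G] ++ unit_vecs).
have := @rat_gf_sum_membership V height _
  (fun T : d.-tuple bool => local_semigroup T) Ts g in_box box
  fg box_fin_gen box_pos_graded box_uniq mem_box.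
apply: (@rat_gf_eventually _ _ 0) => n _; rewrite /box_dim natr_sum.
rewrite big_seq [RHS]big_seq; apply: eq_bigr => v vb; congr (_%:R).
congr pattern_dim; apply/setP => T; rewrite inE degree_pattern_semigroup //.
rewrite (nth_map T) ?index_mem ?mem_enum //.
by rewrite nth_index ?mem_enum.
Qed.

Lemma box_dim_bound n :
  `|box_dim n| <= ((\max_P pattern_dim k p (P : {set d.-tuple bool})) *
                   slope.+1 ^ d)%:R * n.+1%:R ^+ d.
Proof.
rewrite ger0_norm ?ler0n // -natrX -natrM ler_nat.
set D := \max_P _.
apply: (@leq_trans (\sum_(v <- box n) D)).
  by apply: leq_sum => v _; apply: leq_bigmax.
rewrite big_const_seq count_predT iter_addn_0 size_box -mulnA leq_mul2l.
rewrite -expnMn; apply/orP; right; case: d => [|d']; first by rewrite !expn0.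
by rewrite leq_exp2r //; nia.
Qed.

(** The box is itself a finite set of degrees, and it contains every degree that
    contributes. *)
Lemma box_dim_length n l :
  (forall s : seq degree, uniq s -> (\sum_(b <- s) degree_dim n b <= l)%N) ->
  (exists2 s : seq degree, uniq s & (l <= \sum_(b <- s) degree_dim n b)%N) ->
  box_dim n = l%:R.
Proof.
move=> bound [s us ls]; congr (_%:R); apply/eqP; rewrite eqn_leq.
apply/andP; split.
  rewrite -(big_map (fun v : V => v.1) xpredT (degree_dim n)); apply: bound.
  rewrite map_inj_in_uniq ?box_uniq // => v v' /mem_box[_ vn] /mem_box[_ vn'].
  by case: v v' vn vn' => a x [a' x'] /= -> -> ->.
apply: leq_trans ls _.
rewrite -(big_map (fun v : V => v.1) xpredT (degree_dim n)).
set B := [seq v.1 | v <- box n].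
rewrite (bigID (mem B)) /=.
rewrite [X in (_ + X)%N]big1_seq => [|a /andP[aB _]]; last first.
  apply/eqP; apply: contraNT aB => a0; apply/mapP; exists (a, n%:Z) => //.
  apply/mem_box; split=> //; split=> // j.
  by have := degree_dim_box bound a0 j; rewrite PoszM.
rewrite addn0 -big_filter.
have uB : uniq B.
  rewrite map_inj_in_uniq ?box_uniq // => v v' /mem_box[_ vn] /mem_box[_ vn'].
  by case: v v' vn vn' => a x [a' x'] /= -> -> ->.
rewrite (perm_big (filter (mem s) B)) /=.
  by rewrite big_filter big_mkcond leq_sum // => a _; case: ifP.
apply: uniq_perm; rewrite ?filter_uniq // => a.
by rewrite !mem_filter andbC.
Qed.

End Families.

Lemma local_cohomology_box_dim (k : fieldType) (d : nat)
    (I : nat -> ideal {mpoly k[d]})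
    (I_monomial : forall n, monomial_ideal (I n))
    (G : seq ('X_{1..d} * nat)) (i n l : nat)
    (I_graded : graded_family I)
    (GI : forall g, g \in G -> 'X_[g.1] \in I g.2)
    (IG : forall m n, 'X_[m] \in I n -> nat_span
       ([seq embed g.1 g.2 | g <- G] ++ unit_vecs d) (embed m n))
    (E : injective_resolution (quotmod (I n))) :
  has_length (local_cohomology (irrelevant_ideal k d) E i) l ->
  box_dim I G i n = l%:R.
Proof.
move=> [chain_l max_l]; apply: box_dim_length => // [s us|].
  apply: max_l; apply/local_cohomology_chain.
  exact: (koszul_dim_ge (I_monomial n) us).
have [t] := (local_cohomology_chain E i l).1 chain_l.
move=> /koszul_dim_le[//|s [us ls]].
by exists s.
Qed.

Theorem theorem3p8 (k : fieldType) (d : nat)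
    (I : nat -> ideal {mpoly k[d]}) (i : nat)
    (I_monomial : forall n, monomial_ideal (I n))
    (I_graded : graded_family I)
    (I_noetherian : noetherian_family I)
    (E : forall n, injective_resolution (quotmod (I n)))
    (H_finite : exists N, forall n, (N <= n)%N ->
       finite_length (local_cohomology (irrelevant_ideal k d) (E n) i)) :
  (exists f : nat -> rat, quasi_polynomial_deg_le d f /\
     exists N, forall n, (N <= n)%N ->
       exists2 l, has_length (local_cohomology (irrelevant_ideal k d) (E n) i) l
                & f n = l%:R) /\
  (forall s : nat -> rat,
     (forall n l,
        has_length (local_cohomology (irrelevant_ideal k d) (E n) i) l ->
        s n = l%:R) ->
     rational_generating_function s).
Proof.
have [G [GI IG]] := rees_semigroup I_monomial I_noetherian.
have [N NP] := H_finite.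
have gf : rat_gf (box_dim I G i) by apply: box_dim_rat_gf.
have dimE n l :
    has_length (local_cohomology (irrelevant_ideal k d) (E n) i) l ->
    box_dim I G i n = l%:R.
  exact: local_cohomology_box_dim.
split=> [|s sP].
  have [f [fq [M fM]]] :=
    rat_gf_quasi_polynomial (N := 0) gf (fun n _ => box_dim_bound I G i n).
  exists f; split=> //; exists (maxn N M) => n; rewrite geq_max => /andP[Nn Mn].
  by have [l lP] := NP n Nn; exists l; rewrite // -fM // (dimE n l).
apply: rat_gf_rational; apply: rat_gf_eventually gf => n Nn.
by have [l lP] := NP n Nn; rewrite (dimE _ _ lP) (sP _ _ lP).
Qed.
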